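(* $\mathcal{B}(\mathbb{C}_+)\neq\mathcal{A}(\mathbb{C}_+)$ and $\mathcal{B}_0(\mathbb{C}_+)\neq\mathcal{A}_0(\mathbb{C}_+)$.
   Context: Fourier transform $\widehat f(u)=\int f(t)e^{-itu}dt$; $H^1(\mathbb{R})=\{h\in L^1:\widehat h(u)=0\ \forall u\le0\}$. $\mathcal{A}_0(\mathbb{R})$ (resp. $\mathcal{A}(\mathbb{R})$): functions $F=\sum_kf_k\star h_k$ (pointwise) with $(f_k)$ in $C_0(\mathbb{R})$ (resp. bounded uniformly continuous functions $BUC(\mathbb{R})$), $(h_k)\subset H^1(\mathbb{R})$, $\sum\|f_k\|_\infty\|h_k\|_1<\infty$. Besov spaces: fix $\psi$ in the Schwartz class with $\mathrm{supp}\,\psi\subset[\frac12,2]$, $\psi\ge0$, $\psi(t)+\psi(t/2)=1$ on $[1,2]$; $\psi_k(t)=\psi(2^{-k}t)$, $\phi_k=\mathcal{F}^{-1}(\psi_k)$. $\mathcal{B}(\mathbb{R})=\{F\in BUC(\mathbb{R}):\sum_{k\in\mathbb{Z}}\|F\star\phi_k\|_\infty<\infty,\ F=\sum_kF\star\phi_k\}$ (independent of the choice of $\psi$), $\mathcal{B}_0(\mathbb{R})=\mathcal{B}(\mathbb{R})\cap C_0(\mathbb{R})$. For $F$ bounded with analytic Poisson extension $\mathcal{P}[F]$ to the upper half-plane, $\widetilde F(z)=\mathcal{P}[F](iz)$ on $\mathbb{C}_+=\{\mathrm{Re}\,z>0\}$, and $\mathcal{X}(\mathbb{C}_+)=\{\widetilde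 F:F\in\mathcal{X}(\mathbb{R})\}$ for $\mathcal{X}\in\{\mathcal{A},\mathcal{A}_0,\mathcal{B},\mathcal{B}_0\}$. *)

(* Defs.v *)
From HB Require Import structures.
From mathcomp Require Import all_boot all_order all_algebra.
From mathcomp Require Import all_classical all_reals all_analysis.
From mathcomp Require Import complex.
Set Implicit Arguments. Unset Strict Implicit. Unset Printing Implicit Defensive.
Import Order.TTheory GRing.Theory Num.Theory.
Import numFieldNormedType.Exports.
Local Open Scope classical_set_scope.
Local Open Scope ring_scope.

Notation cRe := complex.Re.
Notation cIm := complex.Im.
Notation cabs := Normc.normc.

Definition cofR {R : realType} (x : R) : R[i] := Complex x 0.

Definition cintegrable {R : realType} (f : R -> R[i]) : Prop :=
  (@lebesgue_measure R).-integrable setT (fun t => (cRe (f t))%:E) /\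
  (@lebesgue_measure R).-integrable setT (fun t => (cIm (f t))%:E).

Definition cint {R : realType} (f : R -> R[i]) : R[i] :=
  Complex (Rintegral (@lebesgue_measure R) setT (fun t => cRe (f t)))
          (Rintegral (@lebesgue_measure R) setT (fun t => cIm (f t))).

Definition L1norm {R : realType} (h : R -> R[i]) : R :=
  Rintegral (@lebesgue_measure R) setT (fun t => cabs (h t)).

Definition expi {R : realType} (x : R) : R[i] := Complex (cos x) (sin x).

Definition fourier {R : realType} (f : R -> R[i]) (u : R) : R[i] :=
  cint (fun t => f t * expi (- (t * u))).

Definition ifourier {R : realType} (g : R -> R[i]) (t : R) : R[i] :=
  cofR ((2 * pi)^-1) * cint (fun u => g u * expi (t * u)).

Definition H1 {R : realType} (h : R -> R[i]) : Prop :=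
  cintegrable h /\ forall u : R, u <= 0 -> fourier h u = 0.

Definition conv {R : realType} (f h : R -> R[i]) (x : R) : R[i] :=
  cint (fun t => f (x - t) * h t).

Definition supnorm {R : realType} (f : R -> R[i]) : R :=
  sup (range (fun t => cabs (f t))).

Definition cbounded {R : realType} (f : R -> R[i]) : Prop :=
  exists M : R, forall t, cabs (f t) <= M.

Definition ccontinuous {R : realType} (f : R -> R[i]) : Prop :=
  forall x e : R, 0 < e -> exists2 d : R, 0 < d &
    forall t, `|x - t| < d -> cabs (f x - f t) < e.

Definition cunif_continuous {R : realType} (f : R -> R[i]) : Prop :=
  forall e : R, 0 < e -> exists2 d : R, 0 < d &
    forall s t, `|s - t| < d -> cabs (f s - f t) < e.

Definition BUC {R : realType} (f : R -> R[i]) : Prop :=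
  cbounded f /\ cunif_continuous f.

Definition C0fun {R : realType} (f : R -> R[i]) : Prop :=
  ccontinuous f /\
  forall e : R, 0 < e -> exists M : R, forall t, M < `|t| -> cabs (f t) < e.

Definition cseries_to {R : realType} (a : nat -> R[i]) (L : R[i]) : Prop :=
  (fun n => \sum_(k < n) cRe (a k)) @ \oo --> cRe L /\
  (fun n => \sum_(k < n) cIm (a k)) @ \oo --> cIm L.

Definition rseries_cvg {R : realType} (a : nat -> R) : Prop :=
  exists l : R, (fun n => \sum_(k < n) a k) @ \oo --> l.

Definition zpartial {R : realType} (V : zmodType) (a : int -> V) (N : nat) : V :=
  \sum_(k < N.*2.+1) a (k%:Z - N%:Z).

Definition zcseries_to {R : realType} (a : int -> R[i]) (L : R[i]) : Prop :=
  (fun N => @zpartial R R (fun k => cRe (a k)) N) @ \oo --> cRe L /\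
  (fun N => @zpartial R R (fun k => cIm (a k)) N) @ \oo --> cIm L.

Definition zrseries_cvg {R : realType} (a : int -> R) : Prop :=
  exists l : R, (fun N => @zpartial R R a N) @ \oo --> l.

Definition Aspace {R : realType} (F : R -> R[i]) : Prop :=
  exists (f h : nat -> R -> R[i]),
    (forall k, BUC (f k)) /\ (forall k, H1 (h k)) /\
    rseries_cvg (fun k => supnorm (f k) * L1norm (h k)) /\
    forall x, cseries_to (fun k => conv (f k) (h k) x) (F x).

Definition A0space {R : realType} (F : R -> R[i]) : Prop :=
  exists (f h : nat -> R -> R[i]),
    (forall k, C0fun (f k)) /\ (forall k, H1 (h k)) /\
    rseries_cvg (fun k => supnorm (f k) * L1norm (h k)) /\
    forall x, cseries_to (fun k => conv (f k) (h k) x) (F x).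

(** admissible psi: Schwartz class (D n is the n-th derivative of psi),
    supp psi in [1/2, 2], psi >= 0, psi(t) + psi(t/2) = 1 on [1, 2]. *)
Definition admissible_psi {R : realType} (psi : R -> R) : Prop :=
  (exists D : nat -> R -> R, D 0%N = psi /\
     (forall n x, is_derive x (1 : R) (D n) (D n.+1 x)) /\
     (forall a b : nat, exists M : R, forall t, `|t ^+ a * D b t| <= M)) /\
  (forall t, psi t != 0 -> 2^-1 <= t <= 2) /\
  (forall t, 0 <= psi t) /\
  (forall t, 1 <= t <= 2 -> psi t + psi (t / 2) = 1).

Definition psik {R : realType} (psi : R -> R) (k : int) (t : R) : R :=
  psi (2 ^ (- k) * t).

Definition phik {R : realType} (psi : R -> R) (k : int) : R -> R[i] :=
  ifourier (fun u => cofR (psik psi k u)).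

Definition Bspace {R : realType} (psi : R -> R) (F : R -> R[i]) : Prop :=
  BUC F /\
  zrseries_cvg (fun k => supnorm (conv F (phik psi k))) /\
  forall x, zcseries_to (fun k => conv F (phik psi k) x) (F x).

Definition B0space {R : realType} (psi : R -> R) (F : R -> R[i]) : Prop :=
  Bspace psi F /\ C0fun F.

(** Poisson extension to the upper half-plane:
    P[F](x + iy) = pi^{-1} \int F(t) y / ((x - t)^2 + y^2) dt  (y > 0),
    and  \tilde F(z) = P[F](iz)  for Re z > 0; with z = a + ib, iz = -b + ia. *)
Definition poisson {R : realType} (F : R -> R[i]) (w : R[i]) : R[i] :=
  cofR (pi^-1) * cint (fun t =>
    F t * cofR (cIm w / ((cRe w - t) ^+ 2 + (cIm w) ^+ 2))).

Definition tilde {R : realType} (F : R -> R[i]) (z : R[i]) : R[i] :=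
  poisson F (Complex (- cIm z) (cRe z)).

(** X(C_+) = { \tilde F : F in X(R) }, as functions on C_+ = {Re z > 0}
    (functions C -> C considered through their values on C_+). *)
Definition onCplus {R : realType} (X : (R -> R[i]) -> Prop) : set (R[i] -> R[i]) :=
  [set g | exists F, X F /\ forall z : R[i], 0 < cRe z -> g z = tilde F z].

(* Main.v *)
Require Import Defs.
From HB Require Import structures.
From mathcomp Require Import all_boot all_order all_algebra.
From mathcomp Require Import all_classical all_reals all_analysis.
From mathcomp Require Import complex.
From mathcomp Require Import measurable_realfun.
From mathcomp Require Import ring lra zify.
Import Order.TTheory GRing.Theory Num.Theory.
Import numFieldNormedType.Exports.
Set Implicit Arguments. Unset Strict Implicit. Unset Printing Implicit Defensive.
Local Open Scope classical_set_scope.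
Local Open Scope ring_scope.

(** Proof idea.  One function [F] in [A0] (hence in [A]) that is not in [B]
    settles both claims, because bounded continuous boundary values are
    recovered from the Poisson extension as the height tends to 0.

    Let [phi = F^-1 psi] and [h_k(t) = e^(i 4^k t) phi(t)].  The spectrum of
    [h_k] lies in [[4^k, 2 * 4^k]], where [psi_(2k) + psi_(2k+1) = 1], so
    convolution with [phi_(2k) + phi_(2k+1)] fixes [h_k] and kills every other
    [h_l].  The frequencies are lacunary, so a sum of [N] of the [h_k] has
    [L^1] norm [O(sqrt N)].  Convolving this sum with the damped chirp
    [e^(i a x^2) / (1 + q^2 x^2)] moves the [N] pieces apart: each piece
    [h_k] still has supremum norm bounded below by a constant, so the Besov
    norm is of order [N].  With blocks of [4^j] frequencies and weights
    [4^-j], the sum over [j] converges in [A0], whereas each block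
    contributes at least [1/4] to the Besov norm. *)

(* [conv] is also the name of a convex combination operator. *)
Local Notation conv := Defs.conv.

(** The estimate [cabs (f * h) <= sup |f| * L1norm h] sees a block only through its L^1 norm, while
    the Besov norm adds up the sup norms of its frequency pieces. Expanding the phase
    [a (x - t)^2 + lam t] shows why a chirp exposes the gap between [sqrt N] and [N]: at
    [x = (lam + 1) / (2 a)] the linear term in [t] becomes [-t] for every [lam]. Up to a unimodular
    factor and the damping, each piece therefore takes there the value of the integral of
    [e^(i a t^2) e^(-i t) phi(t)], which is close to [psi 1 = 1] when [a] is small. One [a] thus
    serves all frequencies, each having its own peak. The damping is forced by the function spaces:
    an undamped chirp neither tends to 0 nor is uniformly continuous. It can be made as weak as
    desired, with [q] depending on the block, because a block has finitely many peaks. Block [j]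
    occupies the consecutive pairs of indices [2k], [2k+1] with [4^j <= k < 2 * 4^j]; only the sum
    over a pair is bounded below, and this suffices for the Cauchy criterion to fail. *)

Section complex_numbers.
Context {R : realType}.
Implicit Types (z w : R[i]) (x y : R).

Lemma complex_ext z w : cRe z = cRe w -> cIm z = cIm w -> z = w.
Proof. by case: z w => [a b] [c d] /= -> ->. Qed.

Lemma cReD z w : cRe (z + w) = cRe z + cRe w. Proof. by case: z w => [a b] []. Qed.
Lemma cImD z w : cIm (z + w) = cIm z + cIm w. Proof. by case: z w => [a b] []. Qed.
Lemma cReN z : cRe (- z) = - cRe z. Proof. by case: z. Qed.
Lemma cImN z : cIm (- z) = - cIm z. Proof. by case: z. Qed.
Lemma cReM z w : cRe (z * w) = cRe z * cRe w - cIm z * cIm w.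
Proof. by case: z w => [a b] []. Qed.
Lemma cImM z w : cIm (z * w) = cRe z * cIm w + cIm z * cRe w.
Proof. by case: z w => [a b] []. Qed.
Definition cE := (cReD, cImD, cReN, cImN, cReM, cImM).

Lemma cRe_sum (I : Type) (s : seq I) (P : pred I) (F : I -> R[i]) :
  cRe (\sum_(i <- s | P i) F i) = \sum_(i <- s | P i) cRe (F i).
Proof. exact: (big_morph _ cReD). Qed.

Lemma cIm_sum (I : Type) (s : seq I) (P : pred I) (F : I -> R[i]) :
  cIm (\sum_(i <- s | P i) F i) = \sum_(i <- s | P i) cIm (F i).
Proof. exact: (big_morph _ cImD). Qed.

Lemma cabsE z : cabs z = Num.sqrt (cRe z ^+ 2 + cIm z ^+ 2).
Proof. by case: z. Qed.

Lemma cabs_sqr z : cabs z ^+ 2 = cRe z ^+ 2 + cIm z ^+ 2.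
Proof. by rewrite cabsE sqr_sqrtr// addr_ge0 ?sqr_ge0. Qed.

Lemma cabs_ge0 z : 0 <= cabs z. Proof. by rewrite cabsE sqrtr_ge0. Qed.

Lemma cabsM z w : cabs (z * w) = cabs z * cabs w.
Proof. exact: Normc.normcM. Qed.

Lemma cabs0 : cabs (0 : R[i]) = 0. Proof. exact: Normc.normc0. Qed.

Lemma cabs1 : cabs (1 : R[i]) = 1. Proof. exact: Normc.normc1. Qed.

Lemma cabs_eq0 z : cabs z = 0 -> z = 0. Proof. exact: Normc.eq0_normc. Qed.

Lemma cabsD z w : cabs (z + w) <= cabs z + cabs w.
Proof. exact: le_normcD. Qed.

Lemma cabsN z : cabs (- z) = cabs z. Proof. exact: normcN. Qed.

Lemma cabsB z w : cabs (z - w) <= cabs z + cabs w.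
Proof. by rewrite -(cabsN w) cabsD. Qed.

Lemma cabs_distC z w : cabs (z - w) = cabs (w - z).
Proof. by rewrite -cabsN opprB. Qed.

Lemma cabs_dist z w : cabs z - cabs w <= cabs (z - w).
Proof. by rewrite lerBlDr -{1}(subrK w z) cabsD. Qed.

Lemma cRe_le z : `|cRe z| <= cabs z.
Proof. by rewrite -sqrtr_sqr cabsE ler_wsqrtr// lerDl sqr_ge0. Qed.

Lemma cIm_le z : `|cIm z| <= cabs z.
Proof. by rewrite -sqrtr_sqr cabsE ler_wsqrtr// lerDr sqr_ge0. Qed.

Lemma cabs_leD z : cabs z <= `|cRe z| + `|cIm z|.
Proof.
rewrite -(@ler_pXn2r _ 2)// ?nnegrE ?cabs_ge0 ?addr_ge0// cabs_sqr.
rewrite sqrrD !real_normK ?num_real// [leRHS]addrAC lerDl.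
by rewrite mulrn_wge0// mulr_ge0.
Qed.

Lemma cabs_cofR x : cabs (cofR x) = `|x|.
Proof. by rewrite cabsE /= expr0n addr0 sqrtr_sqr. Qed.

Lemma cofRM x y : cofR (x * y) = cofR x * cofR y.
Proof. by apply: complex_ext; rewrite !cE/=; ring. Qed.

Lemma cofRD x y : cofR (x + y) = cofR x + cofR y.
Proof. by apply: complex_ext; rewrite !cE/=; ring. Qed.

Lemma cofR1 : cofR (1 : R) = 1. Proof. by []. Qed.
Lemma cofR0 : cofR (0 : R) = 0. Proof. by []. Qed.

Lemma cabs_expi x : cabs (expi x) = 1.
Proof. by rewrite cabsE /= cos2Dsin2 sqrtr1. Qed.

Lemma expiD x y : expi (x + y) = expi x * expi y.
Proof. by apply: complex_ext; rewrite !cE/= ?cosD ?sinD//; ring. Qed.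

Lemma expi0 : expi (0 : R) = 1.
Proof. by apply: complex_ext; rewrite /= ?cos0 ?sin0. Qed.

Definition conjugate z : R[i] := Complex (cRe z) (- cIm z).

Lemma cabs_conjugate z : cabs (conjugate z) = cabs z.
Proof. by rewrite !cabsE /= sqrrN. Qed.

Lemma conjugate_mul z : conjugate z * z = cofR (cabs z ^+ 2).
Proof. by rewrite cabs_sqr; apply: complex_ext; rewrite !cE/=; ring. Qed.

End complex_numbers.

(** * Continuity and measurability of complex-valued functions *)

Section complex_measurability.
Context {R : realType}.

(** Componentwise, to match [cintegrable] and [cint], which split a function into real and imaginary
    parts. *)
Definition ccont (f : R -> R[i]) :=
  continuous (fun t => cRe (f t)) /\ continuous (fun t => cIm (f t)).

Definition cmeas d (T : measurableType d) (f : T -> R[i]) :=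
  measurable_fun setT (fun t => cRe (f t)) /\
  measurable_fun setT (fun t => cIm (f t)).

Lemma ccontP (f : R -> R[i]) : ccontinuous f <-> ccont f.
Proof.
split=> [cf|[cr ci] x e e0].
  split=> x; apply/cvgrPdist_lt => e e0; have [d d0 fd] := cf x e e0.
    near=> t; apply: (le_lt_trans _ (fd t _)).
      by rewrite -cReN -cReD cRe_le.
    by near: t; exists d.
  near=> t; apply: (le_lt_trans _ (fd t _)).
    by rewrite -cImN -cImD cIm_le.
  by near: t; exists d.
have e20 : 0 < e / 2 by rewrite divr_gt0.
have /cvgrPdist_lt/(_ _ e20)[d1 d10 H1] := cr x.
have /cvgrPdist_lt/(_ _ e20)[d2 d20 H2] := ci x.
exists (Num.min d1 d2); first by rewrite lt_min d10 d20.
move=> t; rewrite lt_min => /andP[t1 t2].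
rewrite (le_lt_trans (cabs_leD _))// (splitr e) !cE ltrD//.
  exact: H1.
exact: H2.
Unshelve. all: end_near. Qed.

Section closure.
Context d (T : measurableType d).
Implicit Types f g : T -> R[i].

Lemma cmeasD f g : cmeas f -> cmeas g -> cmeas (fun t => f t + g t).
Proof.
move=> [f1 f2] [g1 g2]; split; under eq_fun do rewrite cE;
  exact: measurable_funD.
Qed.

Lemma cmeasN f : cmeas f -> cmeas (fun t => - f t).
Proof.
by move=> [f1 f2]; split; under eq_fun do rewrite cE; exact: measurableT_comp.
Qed.

Lemma cmeasM f g : cmeas f -> cmeas g -> cmeas (fun t => f t * g t).
Proof.
move=> [f1 f2] [g1 g2]; split; under eq_fun do rewrite cE.
  by apply: measurable_funB; exact: measurable_funM.
by apply: measurable_funD; exact: measurable_funM.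
Qed.

Lemma cmeas_cofR (f : T -> R) : measurable_fun setT f ->
  cmeas (fun t => cofR (f t)).
Proof. by move=> mf; split => //=; exact: measurable_cst. Qed.

Lemma cmeas_cst (c : R[i]) : cmeas (fun _ : T => c).
Proof. by split; exact: measurable_cst. Qed.

Lemma cmeas_comp (f : R -> R[i]) (g : T -> R) :
  ccont f -> measurable_fun setT g -> cmeas (fun t => f (g t)).
Proof.
move=> [f1 f2] mg; split; [apply: (measurableT_comp (f := fun t => cRe (f t)))
  | apply: (measurableT_comp (f := fun t => cIm (f t)))] => //;
  exact: continuous_measurable_fun.
Qed.

Lemma cmeas_cabs f : cmeas f -> measurable_fun setT (fun t => cabs (f t)).
Proof.
move=> [f1 f2]; under eq_fun do rewrite cabsE.
apply: (measurableT_comp (f := @Num.sqrt R)) => //.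
  by apply: continuous_measurable_fun; exact: sqrt_continuous.
by apply: measurable_funD; exact: measurable_funX.
Qed.

End closure.

Lemma ccont_cmeas (f : R -> R[i]) : ccont f -> cmeas (fun t : R => f t).
Proof. by move=> cf; apply: cmeas_comp => //; exact: measurable_id. Qed.

Lemma ccontD (f g : R -> R[i]) : ccont f -> ccont g -> ccont (fun t => f t + g t).
Proof.
by move=> [f1 f2] [g1 g2]; split=> x; under eq_fun do rewrite cE;
  rewrite /continuous_at /= ?cE; apply: cvgD; [exact: f1|exact: g1|exact: f2|exact: g2].
Qed.

Lemma ccontM (f g : R -> R[i]) : ccont f -> ccont g -> ccont (fun t => f t * g t).
Proof.
move=> [f1 f2] [g1 g2]; split=> x; under eq_fun do rewrite cE;
  rewrite /continuous_at /= ?cE; [apply: cvgB|apply: cvgD]; apply: cvgM;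
  by [exact: f1|exact: g1|exact: f2|exact: g2].
Qed.

Lemma ccont_cst (c : R[i]) : ccont (fun _ => c).
Proof. by split=> x; exact: cvg_cst. Qed.

Lemma ccont_cofR (f : R -> R) : continuous f -> ccont (fun t => cofR (f t)).
Proof. by move=> cf; split => //= x; exact: cvg_cst. Qed.

Lemma ccont_comp (f : R -> R[i]) (g : R -> R) :
  ccont f -> continuous g -> ccont (fun t => f (g t)).
Proof.
move=> [f1 f2] cg; split => x.
  exact: (continuous_comp (cg x) (f1 _)).
exact: (continuous_comp (cg x) (f2 _)).
Qed.

Lemma ccont_expi : ccont (@expi R).
Proof. by split => x /=; [exact: continuous_cos|exact: continuous_sin]. Qed.

Lemma ccont_sum (I : Type) (s : seq I) (P : pred I) (f : I -> R -> R[i]) :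
  (forall i, ccont (f i)) -> ccont (fun t => \sum_(i <- s | P i) f i t).
Proof.
move=> mf; elim: s => [|i s IH].
  by under eq_fun do rewrite big_nil; exact: ccont_cst.
under eq_fun do rewrite big_cons; case: (P i) => //; exact: ccontD.
Qed.

Lemma ccont_cabs (f : R -> R[i]) : ccont f -> continuous (fun t => cabs (f t)).
Proof.
move=> [f1 f2] x; under eq_fun do rewrite cabsE.
rewrite /continuous_at /= ?cabsE.
apply: (continuous_comp (f := fun t => cRe (f t) ^+ 2 + cIm (f t) ^+ 2)
   (g := @Num.sqrt R)); last exact: sqrt_continuous.
by apply: cvgD; rewrite expr2; under eq_fun do rewrite expr2; apply: cvgM;
  [exact: f1|exact: f1|exact: f2|exact: f2].
Qed.

End complex_measurability.

(** * Lebesgue integrals on the line: linearity, domination, changes of variable *)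

Section real_integrals.
Context {R : realType}.
Local Notation mu := (@lebesgue_measure R).
Implicit Types f g : R -> R.

Definition rintegrable f := mu.-integrable setT (fun t => (f t)%:E).
Definition rint f : R := Rintegral mu setT f.

Lemma eq_rint f g : f =1 g -> rint f = rint g.
Proof. by move=> /funext ->. Qed.

Lemma rintegrable_meas f : rintegrable f -> measurable_fun setT f.
Proof. by move=> /integrableP[/measurable_EFinP]. Qed.

Lemma rintegrable_le f g : measurable_fun setT f -> rintegrable g ->
  (forall t, `|f t| <= g t) -> rintegrable f.
Proof.
move=> mf ig fg; apply: (le_integrable measurableT _ _ ig) => /=.
  exact/measurable_EFinP.
by move=> t _; rewrite lee_fin (le_trans (fg t))// ler_norm.
Qed.

Lemma rintegrableZ f (k : R) : rintegrable f -> rintegrable (fun t => k * f t).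
Proof. by move=> /(integrableZl measurableT k). Qed.

Lemma rintegrableD f g : rintegrable f -> rintegrable g ->
  rintegrable (fun t => f t + g t).
Proof. by move=> intf /(integrableD measurableT intf). Qed.

Lemma rintegrableB f g : rintegrable f -> rintegrable g ->
  rintegrable (fun t => f t - g t).
Proof. by move=> intf /(integrableB measurableT intf). Qed.

Lemma rintegrable0 : rintegrable (fun=> 0).
Proof. exact: integrable0. Qed.

Lemma rintegrable_sum (I : Type) (s : seq I) (P : pred I) (f : I -> R -> R) :
  (forall i, rintegrable (f i)) -> rintegrable (fun t => \sum_(i <- s | P i) f i t).
Proof.
move=> mf; elim: s => [|i s IH].
  by under eq_fun do rewrite big_nil; exact: rintegrable0.
by under eq_fun do rewrite big_cons; case: (P i) => //; exact: rintegrableD.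
Qed.

Lemma rintegrable_norm f : rintegrable f -> rintegrable (fun t => `|f t|).
Proof. by move=> /integrable_norm. Qed.

Lemma rintD f g : rintegrable f -> rintegrable g ->
  rint (fun t => f t + g t) = rint f + rint g.
Proof. exact: RintegralD. Qed.

Lemma rintB f g : rintegrable f -> rintegrable g ->
  rint (fun t => f t - g t) = rint f - rint g.
Proof. exact: RintegralB. Qed.

Lemma rintZ f (k : R) : rintegrable f -> rint (fun t => k * f t) = k * rint f.
Proof. exact: RintegralZl. Qed.

Lemma rint0 : rint (fun=> 0) = 0.
Proof. by rewrite /rint /Rintegral integral0. Qed.

Lemma rint_sum (I : Type) (s : seq I) (P : pred I) (f : I -> R -> R) :
  (forall i, rintegrable (f i)) ->
  rint (fun t => \sum_(i <- s | P i) f i t) = \sum_(i <- s | P i) rint (f i).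
Proof.
move=> mf; elim: s => [|i s IH].
  by under eq_fun do rewrite big_nil; rewrite big_nil; exact: rint0.
under eq_fun do rewrite big_cons; rewrite big_cons; case: (P i) => //.
by rewrite rintD ?IH//; exact: rintegrable_sum.
Qed.

Lemma le_rint f g : rintegrable f -> rintegrable g -> (forall t, f t <= g t) ->
  rint f <= rint g.
Proof. by move=> intf intg fg; exact: le_Rintegral. Qed.

Lemma rint_ge0 f : (forall t, 0 <= f t) -> 0 <= rint f.
Proof. by move=> f0; exact: Rintegral_ge0. Qed.

Lemma integral_rint f : rintegrable f ->
  (\int[mu]_t (f t)%:E = (rint f)%:E)%E.
Proof.
by move=> intf; rewrite /rint /Rintegral fineK//; exact: integrable_fin_num.
Qed.

Lemma rintegrable_ge0P f : measurable_fun setT f -> (forall t, 0 <= f t) ->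
  ((\int[mu]_t (f t)%:E < +oo)%E -> rintegrable f).
Proof.
move=> mf f0 foo; apply/integrableP; split; first exact/measurable_EFinP.
by under eq_integral do rewrite gee0_abs ?lee_fin//.
Qed.

Lemma rint_dominated (f : nat -> R -> R) (g h : R -> R) :
  (forall n, measurable_fun setT (f n)) -> measurable_fun setT h ->
  rintegrable g -> (forall n t, `|f n t| <= g t) ->
  (forall t, f ^~ t @ \oo --> h t) ->
  (fun n => rint (f n)) @ \oo --> rint h.
Proof.
move=> mf mh ig fg fh.
have [] // := @dominated_convergence _ _ R mu setT measurableT
  (fun n t => (f n t)%:E) (fun t => (h t)%:E) (fun t => (g t)%:E).
- by move=> n; apply/measurable_EFinP; exact: mf.
- exact/measurable_EFinP.
- by apply: aeW => t _; apply: cvg_EFin; [apply: nearW|exact: fh].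
- by apply: aeW => t n _; rewrite lee_fin.
by move=> ih _; rewrite integral_rint// => /fine_cvgP[_].
Qed.

Section affine.
Variables (a b : R).
Hypothesis a0 : 0 < a.

Let aff (x : R) : R := a * x + b.

Let d_aff x : is_derive x (1 : R) aff a.
Proof. by apply: is_derive_eq; rewrite /GRing.scale/=; ring. Qed.

Let d1_aff : derive1 aff = cst a.
Proof. by apply/funext => x; rewrite derive1E (@derive_val _ _ _ _ _ _ _ (d_aff x)). Qed.

Let ge0_integral_affine (G : R -> R) : continuous G -> (forall x, 0 <= G x) ->
  (\int[mu]_x (G x)%:E = \int[mu]_x (G (a * x + b) * a)%:E)%E.
Proof.
move=> cG G0.
rewrite (@increasing_ge0_integration_by_substitutionT _ aff G)//.
- by apply: eq_integral => x _; rewrite d1_aff.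
- by move=> x y xy; rewrite /aff ltrD2r ltr_pM2l.
- by rewrite d1_aff => x; exact: cvg_cst.
- by rewrite d1_aff; exact: is_cvg_cst.
- by rewrite d1_aff; exact: is_cvg_cst.
- apply/cvgrNyPle => M; near=> x; rewrite /aff -lerBrDr mulrC -ler_pdivlMr//.
- apply/cvgryPge => M; near=> x; rewrite /aff -lerBlDr mulrC -ler_pdivrMr//.
Unshelve. all: end_near. Qed.

Let caff (G : R -> R) : continuous G -> continuous (fun x => G (a * x + b)).
Proof.
move=> cG x; have ca : {for x, continuous aff}.
  by apply: cvgD; [apply: cvgMl_tmp; exact: cvg_id|exact: cvg_cst].
exact: (continuous_comp ca (cG _)).
Qed.

Let ge0_rint_affine (G : R -> R) : continuous G -> (forall x, 0 <= G x) -> rintegrable G ->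
  rintegrable (fun x => G (a * x + b)) /\
  rint G = a * rint (fun x => G (a * x + b)).
Proof.
move=> cG G0 iG.
have i1 : rintegrable (fun x => G (a * x + b) * a).
  apply: rintegrable_ge0P => [|t|].
  - by apply: measurable_funM => //; apply: continuous_measurable_fun; exact: caff.
  - by rewrite mulr_ge0// ltW.
  - by rewrite -ge0_integral_affine// integral_rint// ltry.
have i2 : rintegrable (fun x => G (a * x + b)).
  have := rintegrableZ a^-1 i1; congr rintegrable; apply/funext => x.
  by rewrite mulrCA mulVf ?gt_eqF// mulr1.
split=> //; rewrite -rintZ//.
have := ge0_integral_affine cG G0; rewrite integral_rint// integral_rint//.
by move=> [->]; apply: eq_rint => x; rewrite mulrC.
Qed.

(** The substitution rule was obtained for nonnegative integrands only; a signed [G] is handled as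
    [(|G| + G) - |G|], a difference of two nonnegative continuous functions. *)
Lemma rint_affine (G : R -> R) : continuous G -> rintegrable G ->
  rintegrable (fun x => G (a * x + b)) /\
  rint G = a * rint (fun x => G (a * x + b)).
Proof.
move=> cG iG.
have cN : continuous (fun x => `|G x|).
  by move=> x; apply: cvg_norm; exact: cG.
have cS : continuous (fun x => `|G x| + G x).
  by move=> x; apply: cvgD; [exact: cN|exact: cG].
have iN := rintegrable_norm iG.
have iS := rintegrableD iN iG.
have [i1 e1] := ge0_rint_affine cN (fun x => normr_ge0 _) iN.
have [|i2 e2] := ge0_rint_affine cS _ iS.
  by move=> x; have := ler_norm (- G x); rewrite normrN; lra.
have eG x : G x = (`|G x| + G x) - `|G x| by rewrite addrAC subrr add0r.
split.
  by have := rintegrableB i2 i1; congr rintegrable; apply/funext => x; rewrite -eG.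
rewrite (eq_rint eG) rintB// e1 e2 -mulrBr -rintB//; congr (_ * _).
by apply: eq_rint => x; rewrite -eG.
Qed.

End affine.

(** The affine substitution above requires a positive slope, so the reflection is treated through
    invariance of Lebesgue measure under pushforward by negation. *)
Lemma rint_reflect f : rintegrable f ->
  rintegrable (fun x => f (- x)) /\ rint (fun x => f (- x)) = rint f.
Proof.
move=> intf; pose N : measurableTypeR R -> measurableTypeR R := -%R.
have mN : measurable_fun setT N by exact: oppr_measurable.
have nuE A : measurable A -> pushforward mu N A = mu A.
  exact: lebesgue_measureN.
have mf : measurable_fun setT (fun t => (f t)%:E).
  by move: intf => /integrableP[].
have i1 : rintegrable (fun x => f (- x)).
  move/integrableP: (intf) => [_ foo]; apply/integrableP; split.
    exact: (measurableT_comp mf mN).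
  have := @ge0_integral_pushforward _ _ _ _ R N mN mu setT
    (fun y => `|(f y)%:E|%E).
  rewrite preimage_setT /= => <-//; last first.
    by apply/measurable_EFinP; exact: (rintegrable_meas (rintegrable_norm intf)).
  by rewrite (eq_measure_integral mu)// => A mA _; exact: nuE.
split=> //; rewrite /rint /Rintegral; congr fine.
have := @integral_pushforward _ _ _ _ R N mN mu setT _ mf.
rewrite preimage_setT /= => <-//.
by apply: eq_measure_integral => A mA _; exact: nuE.
Qed.

End real_integrals.

(** * Complex integrals: triangle inequality, dominated convergence, Fubini *)

Section complex_integrals.
Context {R : realType}.
Local Notation mu := (@lebesgue_measure R).
Implicit Types f g : R -> R[i].

Lemma eq_cint f g : f =1 g -> cint f = cint g.
Proof. by move=> /funext ->. Qed.

Lemma eq_cintegrable f g : f =1 g -> cintegrable f -> cintegrable g.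
Proof. by move=> /funext ->. Qed.

Lemma cintegrable_cmeas f : cintegrable f -> cmeas f.
Proof. by move=> [/rintegrable_meas f1 /rintegrable_meas f2]. Qed.

Lemma cintegrable_le f (g : R -> R) : cmeas f -> rintegrable g ->
  (forall t, cabs (f t) <= g t) -> cintegrable f.
Proof.
move=> [f1 f2] ig fg; split; apply: (rintegrable_le _ ig) => // t.
  exact: le_trans (cRe_le _) (fg t).
exact: le_trans (cIm_le _) (fg t).
Qed.

Lemma cintegrable_cabs f : cintegrable f -> rintegrable (fun t => cabs (f t)).
Proof.
move=> intf; have mf := cintegrable_cmeas intf.
have [/rintegrable_norm f1 /rintegrable_norm f2] := intf.
apply: (rintegrable_le (cmeas_cabs mf) (rintegrableD f1 f2)) => t.
by rewrite ger0_norm ?cabs_ge0// cabs_leD.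
Qed.

Lemma cintegrableM_bounded f g (M : R) : cmeas f -> (forall t, cabs (f t) <= M) ->
  cintegrable g -> cintegrable (fun t => f t * g t).
Proof.
move=> mf fM intg; apply: (cintegrable_le _ (rintegrableZ M (cintegrable_cabs intg))).
  by apply: cmeasM => //; exact: cintegrable_cmeas.
by move=> t; rewrite cabsM ler_wpM2r// cabs_ge0.
Qed.

Lemma cintegrableD f g : cintegrable f -> cintegrable g ->
  cintegrable (fun t => f t + g t).
Proof.
move=> [f1 f2] [g1 g2]; split; under eq_fun do rewrite cE.
  exact: (rintegrableD f1 g1).
exact: (rintegrableD f2 g2).
Qed.

Lemma cintegrableZ (c : R[i]) f : cintegrable f -> cintegrable (fun t => c * f t).
Proof. by move=> fi; apply: (@cintegrableM_bounded (fun=> c) f (cabs c)) => //; exact: cmeas_cst. Qed.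

Lemma cintegrable0 : @cintegrable R (fun=> 0).
Proof. by split; exact: rintegrable0. Qed.

Lemma cintegrable_sum (I : Type) (s : seq I) (P : pred I) (f : I -> R -> R[i]) :
  (forall i, cintegrable (f i)) -> cintegrable (fun t => \sum_(i <- s | P i) f i t).
Proof.
move=> mf; elim: s => [|i s IH].
  by under eq_fun do rewrite big_nil; exact: cintegrable0.
by under eq_fun do rewrite big_cons; case: (P i) => //; exact: cintegrableD.
Qed.

Lemma cintD f g : cintegrable f -> cintegrable g ->
  cint (fun t => f t + g t) = cint f + cint g.
Proof.
move=> [f1 f2] [g1 g2]; apply: complex_ext; rewrite cE /=.
  by rewrite -(rintD f1 g1); apply: eq_rint => t; rewrite cE.
by rewrite -(rintD f2 g2); apply: eq_rint => t; rewrite cE.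
Qed.

Lemma cintZ (c : R[i]) f : cintegrable f -> cint (fun t => c * f t) = c * cint f.
Proof.
move=> [f1 f2]; apply: complex_ext; rewrite cE /=.
  rewrite -/(rint _) -/(rint _) -/(rint _) -(rintZ _ f1) -(rintZ _ f2).
  rewrite -rintB; [|exact: rintegrableZ|exact: rintegrableZ].
  by apply: eq_rint => t; rewrite cE.
rewrite -/(rint _) -/(rint _) -/(rint _) -(rintZ _ f1) -(rintZ _ f2).
rewrite -rintD; [|exact: rintegrableZ|exact: rintegrableZ].
by apply: eq_rint => t; rewrite cE.
Qed.

Lemma cintB f g : cintegrable f -> cintegrable g ->
  cint (fun t => f t - g t) = cint f - cint g.
Proof.
move=> fi gi; rewrite -mulN1r -cintZ// -cintD//; last exact: cintegrableZ.
by apply: eq_cint => t; rewrite mulN1r.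
Qed.

Lemma cintegrableB f g : cintegrable f -> cintegrable g ->
  cintegrable (fun t => f t - g t).
Proof.
move=> fi gi; apply: (eq_cintegrable (f := fun t => f t + (-1) * g t)).
  by move=> t; rewrite mulN1r.
by apply: cintegrableD => //; exact: cintegrableZ.
Qed.

Lemma cint0 : cint (fun=> 0) = 0 :> R[i].
Proof. by apply: complex_ext => /=; exact: rint0. Qed.

Lemma cint_sum (I : Type) (s : seq I) (P : pred I) (f : I -> R -> R[i]) :
  (forall i, cintegrable (f i)) ->
  cint (fun t => \sum_(i <- s | P i) f i t) = \sum_(i <- s | P i) cint (f i).
Proof.
move=> mf; elim: s => [|i s IH].
  by under eq_fun do rewrite big_nil; rewrite big_nil; exact: cint0.
under eq_fun do rewrite big_cons; rewrite big_cons; case: (P i) => //.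
by rewrite cintD ?IH//; exact: cintegrable_sum.
Qed.

Lemma cint_cofR (f : R -> R) : cint (fun t => cofR (f t)) = cofR (rint f).
Proof. by apply: complex_ext => //=; exact: rint0. Qed.

(* Rotating by the conjugate of the integral makes the integral equal to the
   integral of a real part, which is at most the modulus. *)
Lemma cabs_cint f : cintegrable f -> cabs (cint f) <= L1norm f.
Proof.
move=> intf; have [->|c0] := eqVneq (cabs (cint f)) 0.
  by apply: rint_ge0 => t; exact: cabs_ge0.
have {}c0 : 0 < cabs (cint f) by rewrite lt0r c0 cabs_ge0.
rewrite -(ler_pM2l c0) -expr2.
have -> : cabs (cint f) ^+ 2 = rint (fun t => cRe (conjugate (cint f) * f t)).
  have := cintZ (conjugate (cint f)) intf; rewrite conjugate_mul.
  by move=> /(congr1 (@cRe R)) /=.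
rewrite -[X in _ <= _ * X]/(rint (fun t => cabs (f t))).
rewrite -rintZ; last exact: cintegrable_cabs.
apply: le_rint.
- by have [] := cintegrableZ (conjugate (cint f)) intf.
- by apply: rintegrableZ; exact: cintegrable_cabs.
- move=> t; rewrite (le_trans (ler_norm _))// (le_trans (cRe_le _))//.
  by rewrite cabsM cabs_conjugate.
Qed.

Lemma cabs_cint_le f (g : R -> R) : cintegrable f -> rintegrable g ->
  (forall t, cabs (f t) <= g t) -> cabs (cint f) <= rint g.
Proof.
move=> intf intg fg; rewrite (le_trans (cabs_cint intf))//.
by apply: le_rint => //; exact: cintegrable_cabs.
Qed.

(** With convergence phrased through moduli of differences, the real theorem applies to
    [cabs (f n t - g t)] with majorant [b + b], and the triangle inequality for integrals does the
    rest. *)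
Lemma cint_dominated (f : nat -> R -> R[i]) g (b : R -> R) :
  (forall n, cmeas (f n)) -> cmeas g -> rintegrable b ->
  (forall n t, cabs (f n t) <= b t) -> (forall t, cabs (g t) <= b t) ->
  (forall t, (fun n => cabs (f n t - g t)) @ \oo --> (0 : R)) ->
  (fun n => cabs (cint (f n) - cint g)) @ \oo --> (0 : R).
Proof.
move=> mf mg ib fb gb fg.
have fi n := cintegrable_le (mf n) ib (fb n).
have gi := cintegrable_le mg ib gb.
have := @rint_dominated _ (fun n t => cabs (f n t - g t)) (fun t => b t + b t)
  (fun=> 0).
rewrite rint0 => H.
apply: (squeeze_cvgr _ (cvg_cst 0) (H _ _ _ _ _)).
- near=> n; rewrite cabs_ge0 andTb -cintB//; apply: cabs_cint.
  exact: cintegrableB.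
- by move=> n; apply: cmeas_cabs; apply: cmeasD => //; exact: cmeasN.
- exact: measurable_cst.
- exact: rintegrableD.
- move=> n t; rewrite ger0_norm ?cabs_ge0// (le_trans (cabsB _ _))//.
  by rewrite lerD.
- exact: fg.
Unshelve. all: end_near. Qed.

(** Tonelli turns the integrable bound [b] on the norms of the slices into integrability on the
    product, after which Fubini applies. *)
Let real_fubini (f : R -> R -> R) (b : R -> R) :
  measurable_fun setT (fun p : R * R => f p.1 p.2) -> rintegrable b ->
  (forall s, rintegrable (f s)) -> (forall t, rintegrable (f ^~ t)) ->
  (forall s, rint (fun t => `|f s t|) <= b s) ->
  rint (fun s => rint (f s)) = rint (fun t => rint (f ^~ t)).
Proof.
move=> mf ib i1 i2 fb.
have mF : measurable_fun setT (fun p : R * R => (f p.1 p.2)%:E).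
  exact/measurable_EFinP.
have intF : (mu \x mu)%E.-integrable setT (fun p : R * R => (f p.1 p.2)%:E).
  apply/(integrable12ltyP mu mu mF) => /=.
  have bE : (\int[mu]_x `|(b x)%:E| < +oo)%E by move/integrableP: ib => [].
  apply: le_lt_trans bE; apply: ge0_le_integral => //=.
  - by move=> s _; apply: integral_ge0.
  - apply: (measurable_fun_fubini_tonelli_F (m2 := mu)
      (fun p : R * R => `|(f p.1 p.2)%:E|%E)) => //.
    exact: measurableT_comp.
  - by apply/measurable_EFinP; apply: measurableT_comp => //;
       exact: rintegrable_meas.
  - move=> s _; have := integral_rint (rintegrable_norm (i1 s)) => /= ->.
    by rewrite lee_fin (le_trans (fb s))// ler_norm.
have := Fubini (m1 := mu) (m2 := mu) intF => /= E.
rewrite /rint /Rintegral; congr fine.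
under eq_integral do rewrite -/(rint _) -integral_rint//.
by rewrite E; apply: eq_integral => t _; rewrite (integral_rint (i2 t)).
Qed.

Lemma cint_fubini (f : R -> R -> R[i]) (b : R -> R) :
  cmeas (fun p : R * R => f p.1 p.2) -> rintegrable b ->
  (forall s, cintegrable (f s)) -> (forall t, cintegrable (f ^~ t)) ->
  (forall s, L1norm (f s) <= b s) ->
  cint (fun s => cint (f s)) = cint (fun t => cint (f ^~ t)).
Proof.
move=> [m1 m2] ib i1 i2 fb; apply: complex_ext => /=.
- apply: (@real_fubini (fun s t => cRe (f s t)) b) => //.
  + by move=> s; have [] := i1 s.
  + by move=> s; have [] := i2 s.
  + move=> s; apply: le_trans (fb s); apply: le_rint.
    * by apply: rintegrable_norm; have [] := i1 s.
    * exact: cintegrable_cabs.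
    * by move=> t; exact: cRe_le.
- apply: (@real_fubini (fun s t => cIm (f s t)) b) => //.
  + by move=> s; have [] := i1 s.
  + by move=> s; have [] := i2 s.
  + move=> s; apply: le_trans (fb s); apply: le_rint.
    * by apply: rintegrable_norm; have [] := i1 s.
    * exact: cintegrable_cabs.
    * by move=> t; exact: cIm_le.
Qed.

Lemma cint_affine (a b : R) f : 0 < a -> ccont f -> cintegrable f ->
  cintegrable (fun t => f (a * t + b)) /\
  cint f = cofR a * cint (fun t => f (a * t + b)).
Proof.
move=> a0 [c1 c2] [i1 i2].
have [j1 e1] := rint_affine b a0 c1 i1.
have [j2 e2] := rint_affine b a0 c2 i2.
split=> //; apply: complex_ext; rewrite cE /= mul0r ?subr0 ?addr0.
  exact: e1.
exact: e2.
Qed.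

Lemma cint_shift (b : R) f : ccont f -> cintegrable f ->
  cintegrable (fun t => f (t + b)) /\ cint (fun t => f (t + b)) = cint f.
Proof.
move=> cf fi; have [] := cint_affine b ltr01 cf fi.
have -> : (fun t : R => f (1 * t + b)) = fun t => f (t + b).
  by apply/funext => t; rewrite mul1r.
by rewrite cofR1 mul1r.
Qed.

End complex_integrals.

(** * The Poisson extension and the recovery of boundary values *)

Section poisson_kernel.
Context {R : realType}.
Local Notation mu := (@lebesgue_measure R).

(** The Poisson kernel at height 1, times [pi]. The same function also measures the decay of [phik],
    weights the L^2 estimate of the blocks and damps the chirp. *)
Definition lorentz (t : R) : R := (1 + t ^+ 2)^-1.

Lemma lorentz_den (t : R) : 0 < 1 + t ^+ 2.
Proof. by rewrite ltr_pwDl// sqr_ge0. Qed.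

Lemma lorentz_gt0 (t : R) : 0 < lorentz t.
Proof. by rewrite invr_gt0 lorentz_den. Qed.

Lemma continuous_lorentz : continuous lorentz.
Proof. exact: continuous_oneDsqrV. Qed.

Let integral_lorentz : (\int[mu]_t (lorentz t)%:E = pi%:E)%E.
Proof.
rewrite ge0_symfun_integralT; last 3 first.
- by move=> x; rewrite ltW// lorentz_gt0.
- exact: continuous_lorentz.
- by move=> x; rewrite /lorentz /= sqrrN.
have -> : [set x : R | 0 <= x] = `[0%R, +oo[%classic by rewrite set_itvcy.
have -> : (\int[mu]_(x in `[0%R, +oo[) (lorentz x)%:E = (pi / 2)%:E)%E.
  exact: integral0y_oneDsqr.
by rewrite -EFinM; congr EFin; rewrite mulrC divfK.
Qed.

Lemma rintegrable_lorentz : rintegrable lorentz.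
Proof.
apply: rintegrable_ge0P; last by rewrite integral_lorentz ltry.
  by apply: continuous_measurable_fun; exact: continuous_lorentz.
by move=> t; rewrite ltW// lorentz_gt0.
Qed.

Lemma rint_lorentz : rint lorentz = pi.
Proof. by rewrite /rint /Rintegral integral_lorentz. Qed.

Lemma poisson_kernelE (x y t : R) : y != 0 ->
  y / ((x - t) ^+ 2 + y ^+ 2) = y^-1 * lorentz (y^-1 * t + (- x / y)).
Proof.
move=> yn0; rewrite /lorentz; have -> : (x - t) ^+ 2 + y ^+ 2 =
  y * (y * (1 + (y^-1 * t + (- x / y)) ^+ 2)) by field.
by rewrite invfM mulrA divff// mul1r invfM.
Qed.

Lemma continuous_poisson_kernel (x y : R) : y != 0 ->
  continuous (fun t => y / ((x - t) ^+ 2 + y ^+ 2)).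
Proof.
move=> yn0; under eq_fun do rewrite poisson_kernelE//.
move=> t; apply: cvgMl_tmp.
apply: (@continuous_comp _ _ _ (fun t => y^-1 * t + (- x / y)) lorentz).
  by apply: cvgD; [apply: cvgMl_tmp; exact: cvg_id|exact: cvg_cst].
exact: continuous_lorentz.
Qed.

(** Rescaling moves the height [y] from the kernel into the argument of [F]. The weight is then
    fixed, so [M * lorentz] is a majorant for all heights at once. *)
Lemma poisson_substitution (F : R -> R[i]) (M x y : R) : ccont F ->
  (forall t, cabs (F t) <= M) -> 0 < y ->
  poisson F (Complex x y) =
  cofR pi^-1 * cint (fun s => F (y * s + x) * cofR (lorentz s)).
Proof.
move=> cF FM y0; rewrite /poisson /=; congr (_ * _).
have yn0 : y != 0 by rewrite gt_eqF.
pose G t := F t * cofR (y / ((x - t) ^+ 2 + y ^+ 2)).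
have yV0 : 0 < y^-1 by rewrite invr_gt0.
have [ik _] := rint_affine (- x / y) yV0 continuous_lorentz rintegrable_lorentz.
have cG : ccont G.
  by apply: ccontM => //; apply: ccont_cofR; exact: continuous_poisson_kernel.
have iG : cintegrable G.
  apply: (cintegrable_le (ccont_cmeas cG) (rintegrableZ M (rintegrableZ y^-1 ik))).
  move=> t; rewrite /G poisson_kernelE// cabsM cabs_cofR ger0_norm ?ler_wpM2r//;
    by rewrite mulr_ge0 ?(ltW yV0)// ltW// lorentz_gt0.
have [i2 ->] := cint_affine x y0 cG iG.
rewrite -cintZ//; apply: eq_cint => s; rewrite /G mulrCA; congr (_ * _).
rewrite -cofRM; congr cofR; rewrite poisson_kernelE// /lorentz.
have -> : y^-1 * (y * s + x) + - x / y = s by field.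
by rewrite mulrA divff// mul1r.
Qed.

Lemma cvg_invn : (fun n : nat => n.+1%:R^-1 : R) @ \oo --> (0 : R).
Proof. exact: cvg_harmonic. Qed.

Lemma cvg_cabs_seq (F : R -> R[i]) (x : R) (u : nat -> R) : ccont F ->
  u @ \oo --> x -> (fun n => cabs (F (u n) - F x)) @ \oo --> (0 : R).
Proof.
move=> /ccontP cF /cvgrPdist_lt ux; apply/cvgrPdist_lt => e e0.
have [d d0 Fd] := cF x e e0; near=> n.
rewrite sub0r normrN ger0_norm ?cabs_ge0// cabs_distC Fd//.
by near: n; exact: ux.
Unshelve. all: end_near. Qed.

(** [F (y s + x)] tends to [F x] as [y] tends to 0, by continuity; since [lorentz] has mass [pi],
    the dominated limit of the normalised integrals is [F x]. *)
Lemma poisson_cvg (F : R -> R[i]) (M x : R) : ccont F ->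
  (forall t, cabs (F t) <= M) ->
  (fun n => cabs (poisson F (Complex x n.+1%:R^-1) - F x)) @ \oo --> (0 : R).
Proof.
move=> cF FM.
have pin0 : (pi : R) != 0 by rewrite gt_eqF// pi_gt0.
have mc : measurable_fun setT lorentz.
  by apply: continuous_measurable_fun; exact: continuous_lorentz.
have H : (fun n => cabs (cint (fun s => F (n.+1%:R^-1 * s + x) * cofR (lorentz s)) -
    cint (fun s => F x * cofR (lorentz s)))) @ \oo --> (0 : R).
  apply: (cint_dominated (b := fun s => M * lorentz s)).
  - move=> n; apply: cmeasM; last exact: cmeas_cofR.
    by apply: cmeas_comp => //; apply: measurable_funD => //;
      apply: measurable_funM => //; exact: measurable_cst.
  - by apply: cmeasM; [exact: cmeas_cst|exact: cmeas_cofR].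
  - by apply: rintegrableZ; exact: rintegrable_lorentz.
  - move=> n t; rewrite cabsM cabs_cofR ger0_norm ?(ltW (lorentz_gt0 _))//.
    by rewrite ler_pM2r// lorentz_gt0.
  - move=> t; rewrite cabsM cabs_cofR ger0_norm ?(ltW (lorentz_gt0 _))//.
    by rewrite ler_pM2r// lorentz_gt0.
  - move=> t; under eq_fun do rewrite -mulrBl cabsM.
    rewrite -(mul0r (cabs (cofR (lorentz t)))); apply: cvgMr_tmp.
    apply: cvg_cabs_seq => //.
    rewrite -[X in _ --> X]add0r -[X in _ --> X + _](mul0r t).
    by apply: cvgD; [apply: cvgMr_tmp; exact: cvg_invn|exact: cvg_cst].
rewrite -(mulr0 (pi^-1 : R)).
rewrite (_ : (fun n => _) = fun n => pi^-1 * cabs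
    (cint (fun s => F (n.+1%:R^-1 * s + x) * cofR (lorentz s)) -
     cint (fun s => F x * cofR (lorentz s)))); first exact: cvgMl_tmp.
apply/funext => n.
rewrite (poisson_substitution _ cF FM)//.
rewrite -[X in _ = X * _](ger0_norm (x := pi^-1)) ?invr_ge0 ?pi_ge0//.
rewrite -cabs_cofR -cabsM mulrBr; congr (cabs (_ - _)).
rewrite cintZ; last first.
  by split; [exact: rintegrable_lorentz|exact: rintegrable0].
rewrite cint_cofR rint_lorentz mulrCA -cofRM mulVf// cofR1 mulr1//.
Qed.

Lemma cvg_cabs_unique (u : nat -> R[i]) (a b : R[i]) :
  (fun n => cabs (u n - a)) @ \oo --> (0 : R) ->
  (fun n => cabs (u n - b)) @ \oo --> (0 : R) -> a = b.
Proof.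
move=> ua ub; apply/eqP; rewrite -subr_eq0; apply/eqP/cabs_eq0/eqP.
rewrite eq_le cabs_ge0 andbT.
rewrite leNgt; apply/negP => e0.
have e20 : 0 < cabs (a - b) / 2 by rewrite divr_gt0.
move/cvgrPdist_lt/(_ _ e20) : ua => ua; move/cvgrPdist_lt/(_ _ e20) : ub => ub.
near \oo => n.
have h1 : `|0 - cabs (u n - a)| < cabs (a - b) / 2 by near: n.
have h2 : `|0 - cabs (u n - b)| < cabs (a - b) / 2 by near: n.
rewrite sub0r normrN ger0_norm ?cabs_ge0// in h1.
rewrite sub0r normrN ger0_norm ?cabs_ge0// in h2.
have := cabsB (u n - b) (u n - a).
have -> : u n - b - (u n - a) = a - b by ring.
by lra.
Unshelve. all: end_near. Qed.

(** Transfers a comparison of spaces on the half-plane to the line: heights [1/(n+1)] above each [x]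
    already determine the boundary value. *)
Lemma tilde_inj (F G : R -> R[i]) (M N : R) : ccont F -> ccont G ->
  (forall t, cabs (F t) <= M) -> (forall t, cabs (G t) <= N) ->
  (forall z : R[i], 0 < cRe z -> tilde F z = tilde G z) -> F = G.
Proof.
move=> cF cG FM GN FG; apply/funext => x.
apply: (cvg_cabs_unique (poisson_cvg x cF FM)).
rewrite (_ : (fun n => _) = fun n => cabs (poisson G (Complex x n.+1%:R^-1) - G x));
  first exact: poisson_cvg cG GN.
apply/funext => n.
(* The point [z = 1/(n+1) - i x] is chosen so that [i z = x + i/(n+1)]. *)
have /= := FG (Complex n.+1%:R^-1 (- x)); rewrite /tilde /= opprK => ->//.
Qed.

End poisson_kernel.

(** * Fourier inversion by Abel summation *)

Section fourier_inversion.
Context {R : realType}.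
Local Notation mu := (@lebesgue_measure R).

Lemma cvg_expRN (y : R) : 0 < y -> expR (- (y * x)) @[x --> +oo] --> (0 : R).
Proof.
move=> y0; apply: (@cvg_comp _ _ _ (fun x => y * x) (fun x => expR (- x)) _ +oo).
  apply/cvgryPge => M; near=> x; rewrite mulrC -ler_pdivrMr//.
exact: cvgr_expR.
Unshelve. all: end_near. Qed.

Section abel_kernel.
Variables (y d : R).
Hypothesis y0 : 0 < y.

(** Abel's convergence factor. Its Fourier transform is a multiple of the Poisson kernel at height
    [y], so that inversion reduces to [poisson_cvg]. *)
Definition abel (t : R) : R := expR (- (y * `|t|)).

Lemma continuous_abel : continuous abel.
Proof.
move=> t; apply: (@continuous_comp _ _ _ (fun t : R => - (y * `|t|)) expR).
  by apply: cvgN; apply: cvgMl_tmp; exact: norm_continuous.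
exact: continuous_expR.
Qed.

(** Adding 1 to the cosine makes the integrand nonnegative, as needed for the fundamental theorem on
    a half-line; the integral of [abel] alone is subtracted later. *)
Let f (t : R) : R := abel t * (1 + cos (t * d)).

Let f_ge0 t : 0 <= f t.
Proof. by rewrite mulr_ge0 ?expR_ge0// -lerBlDl sub0r cos_geN1. Qed.

Let continuous_cosd : continuous (fun t : R => cos (t * d)).
Proof.
move=> t; apply: (@continuous_comp _ _ _ (fun t : R => t * d) cos).
  by apply: cvgMr_tmp; exact: cvg_id.
exact: continuous_cos.
Qed.

Let cf : continuous f.
Proof.
move=> t; apply: cvgM; first exact: continuous_abel.
by apply: cvgD; [exact: cvg_cst|exact: continuous_cosd].
Qed.

(** The primitive on the positive half-line that vanishes at infinity, so the half-line integral is
    [- A 0]. *)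
Let A (x : R) : R := expR (- (y * x)) *
  ((d * sin (x * d) - y * cos (x * d)) / (y ^+ 2 + d ^+ 2) - y^-1).

Let den : y ^+ 2 + d ^+ 2 != 0.
Proof. by rewrite gt_eqF// ltr_pwDl ?sqr_ge0// exprn_gt0. Qed.

Let dA (x : R) : is_derive x (1 : R) A (expR (- (y * x)) * (1 + cos (x * d))).
Proof.
have yn0 : y != 0 by rewrite gt_eqF.
apply: is_derive_eq; rewrite /GRing.scale/=.
by field; rewrite yn0.
Qed.

Let A0 : A x @[x --> +oo] --> (0 : R).
Proof.
pose C := (`|d| + y) / (y ^+ 2 + d ^+ 2) + y^-1.
have den0 : 0 < y ^+ 2 + d ^+ 2 by rewrite ltr_pwDl ?sqr_ge0// exprn_gt0.
have H : expR (- (y * x)) * C @[x --> +oo] --> (0 : R).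
  by rewrite -(mul0r C); apply: cvgMr_tmp; exact: cvg_expRN.
apply/cvgr0Pnorm_lt => e e0; move/cvgr0Pnorm_lt : H => /(_ _ e0) H.
near=> x; have : `|expR (- (y * x)) * C| < e by near: x.
apply: le_lt_trans; rewrite !normrM ler_wpM2l// (le_trans (ler_normB _ _))//.
rewrite [leRHS]ger0_norm; last first.
  by rewrite addr_ge0// ?invr_ge0 ?(ltW y0)// divr_ge0 ?(ltW den0)// addr_ge0// ltW.
rewrite lerD// ?normrM ?normrV ?unitfE ?gt_eqF// ?[`|y|]gtr0_norm//.
rewrite (gtr0_norm den0) ler_wpM2r ?invr_ge0 ?(ltW den0)//.
rewrite (le_trans (ler_normB _ _))// !normrM (gtr0_norm y0).
rewrite lerD//; first by rewrite ler_piMr// ler_norml sin_geN1 sin_le1.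
by rewrite ler_piMr ?(ltW y0)// ler_norml cos_geN1 cos_le1.
Unshelve. all: end_near. Qed.

Let integral_f : (\int[mu]_t (f t)%:E = (2 / y + 2 * y / (y ^+ 2 + d ^+ 2))%:E)%E.
Proof.
have yn0 : y != 0 by rewrite gt_eqF.
rewrite ge0_symfun_integralT//; last first.
  by move=> x; rewrite /f /abel /= normrN mulNr cosN.
have -> : [set x : R | 0 <= x] = `[0%R, +oo[%classic by rewrite set_itvcy.
have -> : (\int[mu]_(x in `[0%R, +oo[) (f x)%:E =
    \int[mu]_(x in `[0%R, +oo[) (expR (- (y * x)) * (1 + cos (x * d)))%:E)%E.
  apply: eq_integral => x; rewrite inE /= in_itv/= andbT => x0.
  by rewrite /f /abel ger0_norm.
rewrite (ge0_continuous_FTC2y _ _ A0).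
- rewrite -EFinB -EFinM; congr EFin; rewrite /A.
  by rewrite mulr0 oppr0 expR0 mul0r sin0 cos0; field; rewrite ?yn0 ?den.
- by move=> x _; rewrite mulr_ge0 ?expR_ge0// -lerBlDl sub0r cos_geN1.
- apply: continuous_subspaceT => x; apply: cvgM.
    apply: (@continuous_comp _ _ _ (fun t : R => - (y * t)) expR).
      by apply: cvgN; apply: cvgMl_tmp; exact: cvg_id.
    exact: continuous_expR.
  by apply: cvgD; [exact: cvg_cst|exact: continuous_cosd].
- by move=> x _; have := dA x; move/@ex_derive.
- apply: cvg_at_right_filter; apply: differentiable_continuous.
  by apply/derivable1_diffP; have := dA 0; move/@ex_derive.
- by move=> x _; rewrite derive1E; have := dA x; move/@derive_val.
Qed.

Lemma rint_abel_cosD1 : rintegrable (fun t => abel t * (1 + cos (t * d))) /\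
  rint (fun t => abel t * (1 + cos (t * d))) = 2 / y + 2 * y / (y ^+ 2 + d ^+ 2).
Proof.
split; last by rewrite /rint /Rintegral integral_f.
apply: rintegrable_ge0P => //; last by rewrite integral_f ltry.
exact: continuous_measurable_fun.
Qed.

End abel_kernel.

Lemma rint_abel (y : R) : 0 < y -> rintegrable (abel y) /\ rint (abel y) = 2 / y.
Proof.
move=> y0; have [i e] := rint_abel_cosD1 0 y0.
have E : (fun t => 2^-1 * (abel y t * (1 + cos (t * 0)))) = abel y.
  by apply/funext => t; rewrite mulr0 cos0; field.
split; first by have := rintegrableZ 2^-1 i; rewrite E.
by rewrite -E rintZ// e; field; rewrite gt_eqF.
Qed.

(** The cosine part is the difference of the two preceding integrals. The sine part is odd, hence
    equal to its own opposite under [rint_reflect]. *)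
Lemma cint_abel (y d : R) : 0 < y ->
  cint (fun t => cofR (abel y t) * expi (t * d)) = cofR (2 * y / (y ^+ 2 + d ^+ 2)).
Proof.
move=> y0; have [i e] := rint_abel_cosD1 d y0; have [i0 e0] := rint_abel y0.
apply: complex_ext => /=.
  rewrite -/(rint _); transitivity
    (rint (fun t => abel y t * (1 + cos (t * d)) - abel y t)).
    by apply: eq_rint => t; ring.
  by rewrite rintB// e e0; ring.
rewrite -/(rint _); set g := (fun t => _).
have gE : g = fun t => abel y t * sin (t * d) by apply/funext => t; rewrite /g; ring.
have ig : rintegrable g.
  apply: (rintegrable_le _ i0) => [|t].
    rewrite gE; apply: continuous_measurable_fun => t; apply: cvgM; first exact: continuous_abel.
    apply: (@continuous_comp _ _ _ (fun t : R => t * d) sin).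
      by apply: cvgMr_tmp; exact: cvg_id.
    exact: continuous_sin.
  rewrite gE normrM (ger0_norm (expR_ge0 _)) ler_piMr ?expR_ge0//.
  by rewrite ler_norml sin_geN1 sin_le1.
have [_] := rint_reflect ig.
have -> : rint (fun x => g (- x)) = - rint g.
  rewrite -mulN1r -rintZ//; apply: eq_rint => t.
  by rewrite gE /abel normrN mulNr sinN; ring.
by lra.
Qed.

Lemma cabs_abel (y t : R) : 0 < y -> cabs (cofR (abel y t)) <= 1.
Proof.
move=> y0; rewrite cabs_cofR ger0_norm ?expR_ge0// -expR0 ler_expR.
by rewrite oppr_le0 mulr_ge0// ltW.
Qed.

Lemma cintegrable_cofR (f : R -> R) : rintegrable f -> cintegrable (fun t => cofR (f t)).
Proof. by move=> fi; split=> //; exact: rintegrable0. Qed.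

(** Insert [abel y] into the outer integral. As [y] tends to 0 this tends to the Fourier transform
    by domination; by Fubini it also equals the Poisson integral of [chi] at [u + i y], which tends
    to [chi u]. The two limits agree. *)
Lemma fourier_ifourier (chi : R -> R) (M : R) : continuous chi ->
  (forall t, `|chi t| <= M) -> rintegrable chi ->
  cintegrable (ifourier (fun v => cofR (chi v))) ->
  forall u, fourier (ifourier (fun v => cofR (chi v))) u = cofR (chi u).
Proof.
move=> cchi chiM ichi; set g := ifourier _ => ig u.
have mg := cintegrable_cmeas ig.
have mchi : measurable_fun setT chi by exact: continuous_measurable_fun.
have mabel y : measurable_fun setT (abel y).
  by apply: continuous_measurable_fun; exact: continuous_abel.
have mexp : cmeas (fun t : R => expi (- (t * u))).
  by apply: cmeas_comp; [exact: ccont_expi|apply: measurableT_comp => //;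
    exact: measurable_funM].
pose G n t := cofR (abel n.+1%:R^-1 t) * (g t * expi (- (t * u))).
have H1 : (fun n => cabs (cint (G n) - fourier g u)) @ \oo --> (0 : R).
  apply: (cint_dominated (b := fun t => cabs (g t))).
  - by move=> n; apply: cmeasM; [exact: cmeas_cofR|exact: cmeasM].
  - exact: cmeasM.
  - exact: cintegrable_cabs.
  - move=> n t; rewrite /G 2!cabsM cabs_expi mulr1 ler_piMl ?cabs_ge0//.
    exact: cabs_abel.
  - by move=> t; rewrite cabsM cabs_expi mulr1.
  - move=> t; rewrite /G.
    under eq_fun do rewrite -{2}[g t * _]mul1r -mulrBl cabsM.
    rewrite -(mul0r (cabs (g t * expi (- (t * u))))).
    apply: cvgMr_tmp.
    have := @cvg_cabs_seq _ (fun y => cofR (expR (- (y * `|t|)))) 0 _ _ cvg_invn.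
    rewrite mul0r oppr0 expR0; apply; apply: ccont_cofR => y.
    apply: (@continuous_comp _ _ _ (fun y : R => - (y * `|t|)) expR).
      by apply: cvgN; apply: cvgMr_tmp; exact: cvg_id.
    exact: continuous_expR.
apply: (cvg_cabs_unique H1).
have := poisson_cvg u (ccont_cofR cchi) (M := M).
have cM t : cabs (cofR (chi t)) <= M by rewrite cabs_cofR.
move=> /(_ cM); set P := (fun n : nat => _); set Q := (fun n : nat => _).
suff -> : Q = P by [].
apply/funext => n; rewrite /P /Q; congr (cabs (_ - _)).
have y0 : 0 < n.+1%:R^-1 :> R by rewrite invr_gt0.
rewrite /G; clear P Q H1 G; move: (n.+1%:R^-1) y0 => y y0.
have [ia ea] := rint_abel y0.
pose c : R[i] := cofR ((2 * pi)^-1).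
(* Integrating [K] in [v] first gives back the regularised Fourier integral; integrating in [t]
   first gives, by [cint_abel], the Poisson kernel centred at [u]. *)
pose K t v := c * (cofR (chi v) * expi (t * v)) *
  (cofR (abel y t) * expi (- (t * u))).
have KE t v : K t v = (cofR (abel y t) * expi (t * (v - u))) * (c * cofR (chi v)).
  by rewrite /K mulrBr expiD; ring.
have iK t : cintegrable (K t).
  apply: (@eq_cintegrable _ (fun v => c * (cofR (abel y t) * expi (- (t * u))) *
     (expi (t * v) * cofR (chi v)))); first by move=> v; rewrite /K; ring.
  apply: cintegrableZ; apply: (@cintegrableM_bounded _ _ _ 1).
  - apply: cmeas_comp; [exact: ccont_expi|exact: measurable_funM].
  - by move=> v; rewrite cabs_expi.
  - exact: cintegrable_cofR.
have ik2 v : cintegrable (fun t => cofR (abel y t) * expi (t * (v - u))).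
  apply: (@eq_cintegrable _ (fun t => expi (t * (v - u)) * cofR (abel y t))).
    by move=> t; rewrite mulrC.
  apply: (@cintegrableM_bounded _ _ _ 1).
  - apply: cmeas_comp; [exact: ccont_expi|exact: measurable_funM].
  - by move=> t; rewrite cabs_expi.
  - exact: cintegrable_cofR.
transitivity (cint (fun t => cint (K t))).
  apply: eq_cint => t; rewrite /g /ifourier /K.
  under [in RHS]eq_fun do rewrite mulrC.
  rewrite cintZ; last first.
    apply: cintegrableZ.
    apply: (@eq_cintegrable _ (fun v => expi (t * v) * cofR (chi v))).
      by move=> v; rewrite mulrC.
    apply: (@cintegrableM_bounded _ _ _ 1).
    - apply: cmeas_comp; [exact: ccont_expi|exact: measurable_funM].
    - by move=> v; rewrite cabs_expi.
    - exact: cintegrable_cofR.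
  rewrite cintZ; last first.
    apply: (@eq_cintegrable _ (fun v => expi (t * v) * cofR (chi v))).
      by move=> v; rewrite mulrC.
    apply: (@cintegrableM_bounded _ _ _ 1).
    - apply: cmeas_comp; [exact: ccont_expi|exact: measurable_funM].
    - by move=> v; rewrite cabs_expi.
    - exact: cintegrable_cofR.
  by rewrite /c; ring.
rewrite (@cint_fubini _ K (fun t => rint (fun v => cabs c * `|chi v|) * abel y t))//.
- transitivity (cint (fun v => cofR pi^-1 *
     (cofR (chi v) * cofR (y / ((u - v) ^+ 2 + y ^+ 2))))).
    apply: eq_cint => v; under eq_fun do rewrite KE mulrC.
    rewrite cintZ// cint_abel// /c -!cofRM; congr cofR.
    have -> : (u - v) ^+ 2 + y ^+ 2 = y ^+ 2 + (v - u) ^+ 2 by ring.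
    have pin0 : (pi : R) != 0 by rewrite gt_eqF// pi_gt0.
    have dn0 : y ^+ 2 + (v - u) ^+ 2 != 0.
      by rewrite gt_eqF// ltr_pwDl ?sqr_ge0// exprn_gt0.
    by move: (pi : R) pin0 => p pin0; field; rewrite dn0.
  rewrite cintZ//.
  apply: (cintegrable_le _ (rintegrableZ y^-1 (rintegrable_norm ichi))).
    apply: cmeasM; apply: cmeas_cofR => //; apply: continuous_measurable_fun.
    by apply: continuous_poisson_kernel; rewrite gt_eqF.
  move=> v; rewrite cabsM !cabs_cofR mulrC ler_wpM2r// poisson_kernelE ?gt_eqF//.
  rewrite ger0_norm; last first.
    by apply: mulr_ge0; [rewrite invr_ge0 ltW|rewrite ltW// lorentz_gt0].
  rewrite ler_piMr ?invr_ge0 ?(ltW y0)// invf_le1 ?lorentz_den//.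
  by rewrite lerDl sqr_ge0.
- apply: cmeasM; apply: cmeasM.
  + exact: cmeas_cst.
  + apply: cmeasM; first by apply: cmeas_cofR; exact: measurableT_comp.
    by apply: cmeas_comp; [exact: ccont_expi|exact: measurable_funM].
  + apply: cmeas_cofR; exact: (measurableT_comp (mabel y) measurable_fst).
  + apply: cmeas_comp; [exact: ccont_expi|apply: measurableT_comp => //].
    by apply: measurable_funM.
- exact: rintegrableZ.
- by move=> v; under eq_fun do rewrite KE mulrC; exact: cintegrableZ.
- move=> t; rewrite /L1norm -/(rint _) mulrC -rintZ; last first.
    by apply: rintegrableZ; exact: rintegrable_norm.
  rewrite le_eqVlt; apply/orP; left; apply/eqP; apply: eq_rint => v.
  have a0 : 0 <= abel y t by exact: expR_ge0.
  rewrite /K !cabsM !cabs_expi (cabs_cofR (chi v)) (cabs_cofR (abel y t)).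
  by rewrite (ger0_norm a0); ring.
Qed.

End fourier_inversion.

(** * Decay and continuity of inverse transforms of compactly supported functions *)

Section compact_support.
Context {R : realType}.
Local Notation mu := (@lebesgue_measure R).

Lemma is_derive_cont (F f : R -> R) : (forall x, is_derive x (1 : R) F (f x)) ->
  continuous F.
Proof.
move=> Ff z; apply: differentiable_continuous; apply/derivable1_diffP.
by have := Ff z; move/@ex_derive.
Qed.

Lemma is_derive_lipschitz (f df : R -> R) (K : R) :
  (forall x, is_derive x (1 : R) f (df x)) -> (forall x, `|df x| <= K) ->
  forall x y, `|f x - f y| <= K * `|x - y|.
Proof.
move=> fdf dfK x y.
have cf := is_derive_cont fdf.
wlog xy : x y / x <= y => [H|].
  have [xy|/ltW yx] := leP x y; first exact: H.
  by rewrite distrC (distrC x); exact: H.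
have [c _ E] := MVT_segment xy (fun z _ => fdf z) (continuous_subspaceT cf).
by rewrite distrC (distrC x) E normrM ler_wpM2r.
Qed.

Lemma cos_lipschitz (x y : R) : `|cos x - cos y| <= `|x - y|.
Proof.
rewrite -[leRHS]mul1r; apply: (@is_derive_lipschitz cos (fun x => - sin x)) => z.
by rewrite normrN sin_max.
Qed.

Lemma sin_lipschitz (x y : R) : `|sin x - sin y| <= `|x - y|.
Proof.
by rewrite -[leRHS]mul1r; apply: (@is_derive_lipschitz sin cos) => z; rewrite cos_max.
Qed.

Lemma expi_lipschitz (x y : R) : cabs (expi x - expi y) <= 2 * `|x - y|.
Proof.
rewrite (le_trans (cabs_leD _))// !cE /=.
by have := cos_lipschitz x y; have := sin_lipschitz x y; lra.
Qed.

Variables (a b : R).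
Hypothesis ab : a < b.

(** The interval is open, so the endpoints are included among the zeros and boundary terms disappear
    in integrations by parts. *)
Definition vanishes_off (f : R -> R) := forall t, ~~ (a < t < b) -> f t = 0.

Lemma rint_compact (f : R -> R) : continuous f -> vanishes_off f ->
  rintegrable f /\ rint f = Rintegral mu `[a, b] f.
Proof.
move=> cf f0.
have fE : f = f \_ `[a, b].
  apply/funext => t; rewrite patchE; case: ifPn => // /negP; rewrite inE/=.
  rewrite in_itv/= => /negP; rewrite negb_and -!ltNge => h; apply: f0.
  rewrite negb_and -!leNgt; case/orP: h => /ltW ->//; by rewrite orbT.
have ci : mu.-integrable `[a, b] (EFin \o f).
  apply: continuous_compact_integrable; first exact: segment_compact.
  exact: continuous_subspaceT.
split; last by rewrite Rintegral_mkcond -fE.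
have := ci; rewrite integrable_mkcond// restrict_EFin => h.
by rewrite /rintegrable fE.
Qed.

Lemma rint_derive_compact (F f : R -> R) : continuous f ->
  (forall x, is_derive x (1 : R) F (f x)) -> vanishes_off F -> vanishes_off f ->
  rint f = 0.
Proof.
move=> cf Ff F0 f0; have [_ ->] := rint_compact cf f0.
have cF := is_derive_cont Ff.
rewrite /Rintegral (@continuous_FTC2 _ f F a b)//.
- by rewrite (F0 a) ?ltxx// (F0 b) ?ltxx ?andbF//= subr0.
- exact: continuous_subspaceT.
- split.
  + by move=> x _; have := Ff x; move/@ex_derive.
  + by apply: cvg_at_right_filter; exact: cF.
  + by apply: cvg_at_left_filter; exact: cF.
- by move=> x _; rewrite derive1E; have := Ff x; move/@derive_val.
Qed.

Lemma continuous_cosM (t : R) : continuous (fun u : R => cos (t * u)).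
Proof.
move=> u; apply: (@continuous_comp _ _ _ (fun u : R => t * u) cos).
  by apply: cvgMl_tmp; exact: cvg_id.
exact: continuous_cos.
Qed.

Lemma continuous_sinM (t : R) : continuous (fun u : R => sin (t * u)).
Proof.
move=> u; apply: (@continuous_comp _ _ _ (fun u : R => t * u) sin).
  by apply: cvgMl_tmp; exact: cvg_id.
exact: continuous_sin.
Qed.

Lemma cint_expi (f : R -> R) (t : R) :
  cint (fun u => cofR (f u) * expi (t * u)) =
  Complex (rint (fun u => f u * cos (t * u))) (rint (fun u => f u * sin (t * u))).
Proof. by apply: complex_ext => /=; apply: eq_rint => u; ring. Qed.

Lemma rintegrable_compactM (F g : R -> R) : continuous F -> continuous g ->
  vanishes_off F -> rintegrable (fun u => F u * g u).
Proof.
move=> cF cg F0; have [] // := @rint_compact (fun u => F u * g u).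
  by move=> x; apply: cvgM; [exact: cF|exact: cg].
by move=> u /F0 ->; rewrite mul0r.
Qed.

(** The derivative of [F u * cos (t * u)] has integral 0; [parts_cos] uses the sine in the same
    way. *)
Lemma parts_sin (F f : R -> R) (t : R) : continuous f ->
  (forall x, is_derive x (1 : R) F (f x)) -> vanishes_off F -> vanishes_off f ->
  t * rint (fun u => F u * sin (t * u)) = rint (fun u => f u * cos (t * u)).
Proof.
move=> cf Ff F0 f0; have cF := is_derive_cont Ff.
have i1 := rintegrable_compactM cf (@continuous_cosM t) f0.
have i2 := rintegrable_compactM cF (@continuous_sinM t) F0.
rewrite -rintZ//; apply/esym/eqP; rewrite -subr_eq0 -rintB//; last exact: rintegrableZ.
apply/eqP; apply: (@rint_derive_compact (fun u => F u * cos (t * u))).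
- move=> u; apply: cvgB; first by apply: cvgM; [exact: cf|exact: continuous_cosM].
  by apply: cvgMl_tmp; apply: cvgM; [exact: cF|exact: continuous_sinM].
- by move=> u; apply: is_derive_eq; rewrite /GRing.scale/=; ring.
- by move=> u /F0 ->; rewrite mul0r.
- by move=> u h; rewrite F0// f0// !mul0r mulr0 subr0.
Qed.

Lemma parts_cos (F f : R -> R) (t : R) : continuous f ->
  (forall x, is_derive x (1 : R) F (f x)) -> vanishes_off F -> vanishes_off f ->
  t * rint (fun u => F u * cos (t * u)) = - rint (fun u => f u * sin (t * u)).
Proof.
move=> cf Ff F0 f0; have cF := is_derive_cont Ff.
have i1 := rintegrable_compactM cf (@continuous_sinM t) f0.
have i2 := rintegrable_compactM cF (@continuous_cosM t) F0.
rewrite -rintZ//; apply/eqP; rewrite -subr_eq0 opprK -rintD//; last exact: rintegrableZ.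
apply/eqP; apply: (@rint_derive_compact (fun u => F u * sin (t * u))).
- move=> u; apply: cvgD; last by apply: cvgM; [exact: cf|exact: continuous_sinM].
  by apply: cvgMl_tmp; apply: cvgM; [exact: cF|exact: continuous_cosM].
- by move=> u; apply: is_derive_eq; rewrite /GRing.scale/=; ring.
- by move=> u /F0 ->; rewrite mul0r.
- by move=> u h; rewrite F0// f0// !mul0r mulr0 addr0.
Qed.

Lemma cintegrable_cofR_expi (f : R -> R) (t : R) : rintegrable f ->
  cintegrable (fun u => cofR (f u) * expi (t * u)).
Proof.
move=> fi; apply: (@eq_cintegrable _ (fun u => expi (t * u) * cofR (f u))).
  by move=> u; rewrite mulrC.
apply: (@cintegrableM_bounded _ _ _ 1).
- by apply: cmeas_comp; [exact: ccont_expi|exact: measurable_funM].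
- by move=> v; rewrite cabs_expi.
- exact: cintegrable_cofR.
Qed.

Lemma cabs_cint_expi (f : R -> R) (t : R) : rintegrable f ->
  cabs (cint (fun u => cofR (f u) * expi (t * u))) <= rint (fun u => `|f u|).
Proof.
move=> fi; apply: cabs_cint_le.
- exact: cintegrable_cofR_expi.
- exact: rintegrable_norm.
- by move=> u; rewrite cabsM cabs_expi mulr1 cabs_cofR.
Qed.

(** Two integrations by parts exchange the factor [t^2] for the second derivative, up to sign.
    Adding the trivial bound for the factor 1 controls [1 + t^2] times the transform by the L^1
    norms of [f] and [f2]. *)
Lemma ifourier_decay (f f1 f2 : R -> R) : continuous f2 ->
  (forall x, is_derive x (1 : R) f (f1 x)) ->
  (forall x, is_derive x (1 : R) f1 (f2 x)) ->
  vanishes_off f -> vanishes_off f1 -> vanishes_off f2 ->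
  exists C : R, forall t, cabs (ifourier (fun u => cofR (f u)) t) <= C * lorentz t.
Proof.
move=> cf2 d1 d2 v0 v1 v2.
have cf1 := is_derive_cont d2; have cf := is_derive_cont d1.
have [i0 _] := rint_compact cf v0; have [i2 _] := rint_compact cf2 v2.
pose I0 := rint (fun u => `|f u|); pose I2 := rint (fun u => `|f2 u|).
exists (`|(2 * pi)^-1| * (I0 + I2)) => t; rewrite /ifourier cabsM cabs_cofR -mulrA.
rewrite ler_wpM2l// ler_pdivlMr ?lorentz_den// mulrDr mulr1 lerD//.
  exact: cabs_cint_expi.
apply: le_trans (cabs_cint_expi t i2).
rewrite -[X in _ * X]ger0_norm ?sqr_ge0// -cabs_cofR -cabsM.
rewrite -[leRHS]cabsN; rewrite le_eqVlt; apply/orP; left; apply/eqP; congr cabs.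
rewrite !cint_expi; apply: complex_ext; rewrite ?cE /= mulr0 ?subr0 ?add0r ?addr0.
  by rewrite mulrC expr2 -mulrA parts_cos// mulrN parts_sin.
by rewrite mulrC expr2 -mulrA parts_sin// parts_cos.
Qed.

(** The integral is Lipschitz in [t], because [expi (t * u)] is Lipschitz with constant [2 |u|] and
    [|f u| * 2 |u|] is integrable. Dividing by [L + 1] avoids the case [L = 0]. *)
Lemma ccont_ifourier (f : R -> R) : continuous f -> vanishes_off f ->
  ccont (ifourier (fun u => cofR (f u))).
Proof.
move=> cf v0; have [fi _] := rint_compact cf v0.
rewrite /ifourier; apply: ccontM; first exact: ccont_cst.
pose L := rint (fun u => `|f u| * (2 * `|u|)).
have cnf : continuous (fun u => `|f u|) by move=> u; apply: cvg_norm; exact: cf.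
have iL : rintegrable (fun u => `|f u| * (2 * `|u|)).
  apply: rintegrable_compactM => //.
    by move=> u; apply: cvgMl_tmp; exact: norm_continuous.
  by move=> u /v0 ->; rewrite normr0.
have L0 : 0 <= L by apply: rint_ge0 => u; rewrite !mulr_ge0.
apply/ccontP => x e e0; exists (e / (L + 1)) => [|t xt].
  by rewrite divr_gt0// ltr_wpDl.
rewrite -cintB; [|exact: cintegrable_cofR_expi|exact: cintegrable_cofR_expi].
apply: (@le_lt_trans _ _ (`|x - t| * L)).
  rewrite -rintZ//; apply: cabs_cint_le.
  - by apply: cintegrableB; exact: cintegrable_cofR_expi.
  - exact: rintegrableZ.
  - move=> u; rewrite -mulrBr cabsM cabs_cofR mulrCA ler_wpM2l//.
    by rewrite (le_trans (expi_lipschitz _ _))// -mulrBl normrM mulrCA.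
rewrite ltr_pdivlMr ?ltr_wpDl// in xt; apply: le_lt_trans xt.
by rewrite ler_wpM2l// lerDl.
Qed.

End compact_support.

(** * Convolution: bounds, associativity, action on the Fourier side *)

Section convolution.
Context {R : realType}.
Implicit Types f h g : R -> R[i].

Lemma cintegrable_conv f h (M x : R) : ccont f -> (forall t, cabs (f t) <= M) ->
  cintegrable h -> cintegrable (fun t => f (x - t) * h t).
Proof.
move=> cf fM ih; apply: (@cintegrableM_bounded _ _ _ M) => //.
by apply: cmeas_comp => //; apply: measurable_funB => //; exact: measurable_cst.
Qed.

Lemma cabs_conv f h (M x : R) : ccont f -> (forall t, cabs (f t) <= M) ->
  cintegrable h -> cabs (conv f h x) <= M * L1norm h.
Proof.
move=> cf fM ih; rewrite /L1norm -/(rint _) -rintZ; last exact: cintegrable_cabs.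
apply: cabs_cint_le; first exact: cintegrable_conv fM ih.
  by apply: rintegrableZ; exact: cintegrable_cabs.
by move=> t; rewrite cabsM ler_wpM2r// cabs_ge0.
Qed.

Lemma L1norm_ge0 h : 0 <= L1norm h.
Proof. by apply: rint_ge0 => t; exact: cabs_ge0. Qed.

Lemma ccont_conv f h (M : R) : ccont f -> cunif_continuous f ->
  (forall t, cabs (f t) <= M) -> cintegrable h -> ccont (conv f h).
Proof.
move=> cf ucf fM ih; apply/ccontP => x e e0.
have L0 := L1norm_ge0 h.
have e1 : 0 < e / (L1norm h + 1) by rewrite divr_gt0// ltr_wpDl.
have [d d0 fd] := ucf _ e1; exists d => // t xt.
rewrite /conv -cintB; [|exact: cintegrable_conv fM ih|exact: cintegrable_conv fM ih].
apply: (@le_lt_trans _ _ (e / (L1norm h + 1) * L1norm h)); last first.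
  by rewrite mulrAC ltr_pdivrMr ?ltr_wpDl// ltr_pM2l// ltrDl.
rewrite [X in _ * X]/L1norm -/(rint _) -rintZ; last exact: cintegrable_cabs.
apply: cabs_cint_le.
- by apply: cintegrableB; exact: cintegrable_conv fM ih.
- by apply: rintegrableZ; exact: cintegrable_cabs.
- move=> s; rewrite -mulrBl cabsM ler_wpM2r ?cabs_ge0// ltW// fd//.
  by have -> : x - s - (t - s) = x - t by ring.
Qed.

(** Fubini, then the translation [s = r - t] in the inner integral, then Fubini again. This form
    lets a Littlewood-Paley kernel [g] pass through the chirp [f] and act on the block [h]
    directly. *)
Lemma conv_assoc f h g (M N x : R) : ccont f -> (forall t, cabs (f t) <= M) ->
  ccont h -> cintegrable h ->
  ccont g -> cintegrable g -> (forall t, cabs (g t) <= N) ->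
  conv (conv f h) g x = conv f (conv g h) x.
Proof.
move=> cf fM ch ih cg ig gN.
have mBc (c : R) : measurable_fun setT (fun t : R => c - t).
  by apply: measurable_funB => //; exact: measurable_cst.
pose K s t := g s * (f (x - s - t) * h t).
pose K' t r := f (x - r) * (g (r - t) * h t).
have iK s : cintegrable (K s) by apply: cintegrableZ; exact: cintegrable_conv fM ih.
have iK2 t : cintegrable (K ^~ t).
  rewrite /K; apply: (@eq_cintegrable _ (fun s => h t * (f (x - t - s) * g s))).
    by move=> s; rewrite [x - s - t]addrAC; ring.
  by apply: cintegrableZ; exact: cintegrable_conv fM ig.
transitivity (cint (fun s => cint (K s))).
  apply: eq_cint => s; rewrite /conv mulrC -cintZ//.
  exact: cintegrable_conv fM ih.
rewrite (@cint_fubini _ K (fun s => (M * L1norm h) * cabs (g s)))//; last 3 first.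
- apply: cmeasM; first by apply: cmeas_comp.
  apply: cmeasM; apply: cmeas_comp => //.
  apply: measurable_funB => //; apply: measurable_funB => //; exact: measurable_cst.
- by apply: rintegrableZ; exact: cintegrable_cabs.
- move=> s; rewrite mulrC /L1norm -/(rint _) -/(rint _) -rintZ; last exact: cintegrable_cabs.
  rewrite -rintZ; last by apply: rintegrableZ; exact: cintegrable_cabs.
  apply: le_rint.
  + exact: cintegrable_cabs.
  + by do 2! apply: rintegrableZ; exact: cintegrable_cabs.
  + by move=> t; rewrite /K !cabsM ler_wpM2l ?cabs_ge0// ler_wpM2r ?cabs_ge0.
have cK t : ccont (K ^~ t).
  apply: ccontM => //; apply: ccontM; last exact: ccont_cst.
  apply: ccont_comp => // s; apply: cvgB; last exact: cvg_cst.
  by apply: cvgB; [exact: cvg_cst|exact: cvg_id].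
have KK' t : cintegrable (K' t) /\ cint (K ^~ t) = cint (K' t).
  have [i <-] := cint_shift (- t) (cK t) (iK2 t).
  have E : (fun r => K (r - t) t) = K' t.
    apply/funext => r; rewrite /K /K'.
    have -> : x - (r - t) - t = x - r by ring.
    by rewrite mulrCA.

  by rewrite -E.
under eq_cint do rewrite (KK' _).2.
have iK' r : cintegrable (K' ^~ r).
  by apply: cintegrableZ; exact: cintegrable_conv gN ih.
have gL1 t : rint (fun r => cabs (g (r - t))) = L1norm g.
  have [_] := rint_affine (- t) ltr01 (ccont_cabs cg) (cintegrable_cabs ig).
  by rewrite mul1r /L1norm -/(rint _) => ->; apply: eq_rint => r; rewrite mul1r.
have ig' t : rintegrable (fun r => cabs (g (r - t))).
  have [i _] := rint_affine (- t) ltr01 (ccont_cabs cg) (cintegrable_cabs ig).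
  by move: i; congr rintegrable; apply/funext => r; rewrite mul1r.
rewrite (@cint_fubini _ K' (fun t => (M * L1norm g) * cabs (h t)))//.
- by apply: eq_cint => r; rewrite cintZ//; exact: cintegrable_conv gN ih.
- apply: cmeasM.
    by apply: cmeas_comp => //; apply: measurable_funB => //; exact: measurable_cst.
  by apply: cmeasM; apply: cmeas_comp => //; exact: measurable_funB.
- by apply: rintegrableZ; exact: cintegrable_cabs.
- by move=> t; have [] := KK' t.
- move=> t; rewrite -(gL1 t) mulrAC -rintZ//.
  apply: le_rint; [by apply: cintegrable_cabs; have [] := KK' t|exact: rintegrableZ|].
  move=> r; rewrite /K' !cabsM [leRHS]mulrAC -mulrA.
  by rewrite ler_wpM2r ?fM// mulr_ge0 ?cabs_ge0.
Qed.

(** Writing the first factor as an inverse transform and exchanging integrals produces [fourier h]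
    under the integral sign, so no inversion theorem is required. *)
Lemma conv_ifourier (chi ghat : R -> R) h (N r : R) : continuous chi ->
  rintegrable chi -> cintegrable h -> continuous ghat ->
  (forall v, `|ghat v| <= N) -> (forall v, fourier h v = cofR (ghat v)) ->
  conv (ifourier (fun v => cofR (chi v))) h r =
  ifourier (fun v => cofR (chi v * ghat v)) r.
Proof.
move=> cchi ichi ih cg gN hE.
have mchi : measurable_fun setT chi by exact: continuous_measurable_fun.
pose c : R[i] := cofR ((2 * pi)^-1).
pose K t v := h t * (c * (cofR (chi v) * expi ((r - t) * v))).
have iK t : cintegrable (K t).
  by do 2! apply: cintegrableZ; exact: cintegrable_cofR_expi.
have KE t v : K t v = c * cofR (chi v) * expi (r * v) * (h t * expi (- (t * v))).
  by rewrite /K mulrBl expiD; ring.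
have ihe v : cintegrable (fun t => h t * expi (- (t * v))).
  apply: (@eq_cintegrable _ (fun t => expi (- (t * v)) * h t)).
    by move=> t; rewrite mulrC.
  apply: (@cintegrableM_bounded _ _ _ 1) => //; last by move=> t; rewrite cabs_expi.
  apply: cmeas_comp; first exact: ccont_expi.
  by apply: measurableT_comp => //; exact: measurable_funM.
transitivity (cint (fun t => cint (K t))).
  apply: eq_cint => t; rewrite /K cintZ; last first.
    by apply: cintegrableZ; exact: cintegrable_cofR_expi.
  rewrite cintZ; last exact: cintegrable_cofR_expi.
  by rewrite /ifourier mulrC.
rewrite (@cint_fubini _ K (fun t => rint (fun v => cabs c * `|chi v|) * cabs (h t)))//.
- transitivity (cint (fun v => c * (cofR (chi v * ghat v) * expi (r * v)))).
    apply: eq_cint => v; under eq_cint do rewrite KE.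
    by rewrite cintZ// -/(fourier h v) hE cofRM; ring.
  rewrite cintZ//; apply: cintegrable_cofR_expi.
  apply: (rintegrable_le _ (rintegrableZ N (rintegrable_norm ichi))).
    apply: continuous_measurable_fun => v.
    by apply: cvgM; [exact: cchi|exact: cg].
  by move=> v; rewrite normrM mulrC ler_wpM2r.
- apply: cmeasM.
    have [m1 m2] := cintegrable_cmeas ih.
    by split; [exact: (measurableT_comp m1 measurable_fst)
      |exact: (measurableT_comp m2 measurable_fst)].
  apply: cmeasM; first exact: cmeas_cst.
  apply: cmeasM; first by apply: cmeas_cofR; exact: (measurableT_comp mchi measurable_snd).
  apply: cmeas_comp; first exact: ccont_expi.
  apply: measurable_funM => //; apply: measurable_funB => //; exact: measurable_cst.
- by apply: rintegrableZ; exact: cintegrable_cabs.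
- by move=> v; under eq_fun do rewrite KE; exact: cintegrableZ.
- move=> t; rewrite mulrC -rintZ; last first.
    by apply: rintegrableZ; exact: rintegrable_norm.
  rewrite le_eqVlt; apply/orP; left; apply/eqP; apply: eq_rint => v.
  by rewrite /K !cabsM cabs_expi (cabs_cofR (chi v)); ring.
Qed.

End convolution.

(** * Littlewood-Paley kernels of an admissible [psi] and modulated waves *)

Section admissible.
Context {R : realType}.
Variable psi : R -> R.
Hypothesis psiP : admissible_psi psi.

(** Each derivative is zero on the open set [t < 1/2] or [2 < t], since the preceding one is locally
    zero there. *)
Let derivatives : exists D : nat -> R -> R, [/\ D 0%N = psi,
  forall n x, is_derive x (1 : R) (D n) (D n.+1 x) &
  forall n t, t < 2^-1 \/ 2 < t -> D n t = 0].
Proof.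
have [[D [D0 [dD _]]] [supp _]] := psiP; exists D; split => //.
elim=> [|n IH] t ht.
  apply/eqP/negPn/negP; rewrite D0 => /supp; case: ht => ht.
    by rewrite leNgt ht.
  by rewrite [t <= 2]leNgt ht andbF.
have d0 : is_derive t (1 : R) (cst 0) (D n.+1 t).
  apply: near_eq_is_derive (dD n t).
  case: ht => ht.
    have : \forall x \near t, x < 2^-1 by exact: lt_nbhsl.
    by apply: filterS => x hx; rewrite IH//; left.
  have : \forall x \near t, 2 < x by exact: lt_nbhsr.
  by apply: filterS => x hx; rewrite IH//; right.
have /@derive_val <- := d0.
by have /@derive_val -> := @is_derive_cst _ _ _ (0 : R) t (1 : R).
Qed.

Lemma psi_continuous : continuous psi.
Proof. by have [D [<- dD _]] := derivatives; exact: is_derive_cont. Qed.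

Lemma psi_bounded : exists M : R, forall t, `|psi t| <= M.
Proof.
have [[D [D0 [_ /(_ 0%N 0%N)[M HM]]]] _] := psiP; exists M => t.
by have := HM t; rewrite expr0 mul1r D0.
Qed.

Lemma psi_supp t : t < 2^-1 \/ 2 < t -> psi t = 0.
Proof. by have [D [<- _ +]] := derivatives; exact. Qed.

(** The support condition still allows the endpoint [1/2]; continuity from the left settles it. *)
Lemma psi_half : psi 2^-1 = 0.
Proof.
have H : psi x @[x --> (2^-1 : R)^'-] --> psi 2^-1.
  by apply: cvg_at_left_filter; exact: psi_continuous.
have H0 : psi x @[x --> (2^-1 : R)^'-] --> (0 : R).
  apply/cvgrPdist_lt => e e0; near=> x.
  rewrite psi_supp ?subrr ?normr0//; left.
  by near: x; exact: nbhs_left_lt.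
exact: (cvg_unique _ H H0).
Unshelve. all: end_near. Qed.

(** The partition identity at the left end [t = 1]. This value is what keeps each chirped piece away
    from 0. *)
Lemma psi_1 : psi 1 = 1.
Proof.
have [_ [_ [_ /(_ 1)]]] := psiP.
by rewrite mul1r psi_half addr0; apply; rewrite lexx/= ler1n.
Qed.

Lemma scale_gt0 (k : int) : 0 < 2 ^ (- k) :> R.
Proof. by rewrite exprz_gt0. Qed.

Lemma psik_continuous k : continuous (psik psi k).
Proof.
move=> t; apply: (@continuous_comp _ _ _ (fun t : R => 2 ^ (- k) * t) psi).
  by apply: cvgMl_tmp; exact: cvg_id.
exact: psi_continuous.
Qed.

(** The support of [psik psi k] ends at [2 * 2^k]; the endpoint [3 * 2^k] leaves a margin, so that
    derivatives vanish there too. *)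
Let bound_gt0 k : 0 < 3 / 2 ^ (- k) :> R.
Proof. by rewrite divr_gt0// scale_gt0. Qed.

Let off k (t : R) : ~~ (0 < t < 3 / 2 ^ (- k)) ->
  2 ^ (- k) * t < 2^-1 \/ 2 < 2 ^ (- k) * t.
Proof.
have s0 := scale_gt0 k; rewrite negb_and -!leNgt => /orP[t0|].
  by left; rewrite (@le_lt_trans _ _ 0)// pmulr_rle0.
by rewrite ler_pdivrMr// mulrC => h; right; apply: lt_le_trans h; rewrite ltr_nat.
Qed.

Lemma psik_vanishes k : vanishes_off 0 (3 / 2 ^ (- k)) (psik psi k).
Proof. by move=> t /off; exact: psi_supp. Qed.

Lemma psik_rintegrable k : rintegrable (psik psi k).
Proof.
by have [] := rint_compact (@psik_continuous k) (@psik_vanishes k).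
Qed.

Lemma phik_ccont k : ccont (phik psi k).
Proof. exact: (ccont_ifourier (@psik_continuous k) (@psik_vanishes k)). Qed.

Lemma phik_decay k :
  exists2 C : R, 0 < C & forall t, cabs (phik psi k t) <= C * lorentz t.
Proof.
have [D [D0 dD Dv]] := derivatives; set s : R := 2 ^ (- k).
have [C HC] : exists C : R, forall t, cabs (phik psi k t) <= C * lorentz t.
  apply: (@ifourier_decay _ 0 (3 / s) (bound_gt0 k) (psik psi k)
    (fun t => s * D 1%N (s * t)) (fun t => s ^+ 2 * D 2%N (s * t))) => //.
  - move=> t; apply: cvgMl_tmp.
    apply: (@continuous_comp _ _ _ (fun t : R => s * t) (D 2%N)).
      by apply: cvgMl_tmp; exact: cvg_id.
    exact: is_derive_cont (dD 2%N) _.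
  - move=> x; rewrite /psik -D0.
    have d1 : is_derive x (1 : R) (fun t => s * t) s.
      by apply: is_derive_eq; rewrite /GRing.scale/=; ring.
    have := @is_derive1_comp _ (D 0%N) (fun t : R => s * t) x _ _ (dD 0%N (s * x)) d1.
    by rewrite mulrC.
  - move=> x.
    have d1 : is_derive x (1 : R) (fun t => s * t) s.
      by apply: is_derive_eq; rewrite /GRing.scale/=; ring.
    have d2 := @is_derive1_comp _ (D 1%N) (fun t : R => s * t) x _ _ (dD 1%N (s * x)) d1.
    have := @is_deriveZ _ _ _ (D 1%N \o (fun t : R => s * t)) s x (1 : R) _ d2.
    rewrite /GRing.scale/= => h; apply: is_derive_eq; ring.
  - exact: psik_vanishes.
  - by move=> t /off h; rewrite Dv// mulr0.
  - by move=> t /off h; rewrite Dv// mulr0.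
(* The maximum with 1 makes the constant strictly positive, which permits cancelling it in later
   inequalities. *)
exists (Num.max C 1) => [|t]; first by rewrite lt_max ltr01 orbT.
rewrite (le_trans (HC t))// ler_wpM2r ?(ltW (lorentz_gt0 _))//.
by rewrite le_max lexx.
Qed.

Lemma phik_cintegrable k : cintegrable (phik psi k).
Proof.
have [C _ HC] := phik_decay k.
apply: (cintegrable_le (ccont_cmeas (phik_ccont k)) _ HC).
by apply: rintegrableZ; exact: rintegrable_lorentz.
Qed.

Lemma phik_bounded k : exists N : R, forall t, cabs (phik psi k t) <= N.
Proof.
have [C C0 HC] := phik_decay k; exists C => t; rewrite (le_trans (HC t))//.
by rewrite ler_piMr ?(ltW C0)// invf_le1 ?lorentz_den// lerDl sqr_ge0.
Qed.

Lemma psik0 : psik psi 0 = psi.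
Proof. by apply/funext => t; rewrite /psik oppr0 expr0z mul1r. Qed.

Lemma fourier_phi0 (u : R) : fourier (phik psi 0) u = cofR (psi u).
Proof.
have [M HM] := psi_bounded.
have := @fourier_ifourier _ (psik psi 0) M (@psik_continuous 0).
rewrite psik0 => H; rewrite /phik psik0; apply: H => //.
  by have := psik_rintegrable 0; rewrite psik0.
by have := phik_cintegrable 0; rewrite /phik psik0.
Qed.

(** Modulation translates the spectrum: the transform is [psi (u - lam)], carried by
    [[lam + 1/2, lam + 2]]. With [lam = 4^k] this is [h_k]. *)
Definition wave (lam t : R) : R[i] := expi (lam * t) * phik psi 0 t.

Lemma wave_ccont lam : ccont (wave lam).
Proof.
apply: ccontM; last exact: phik_ccont.
apply: ccont_comp; first exact: ccont_expi.
by move=> t; apply: cvgMl_tmp; exact: cvg_id.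
Qed.

Lemma cabs_wave lam t : cabs (wave lam t) = cabs (phik psi 0 t).
Proof. by rewrite cabsM cabs_expi mul1r. Qed.

Lemma wave_cintegrable lam : cintegrable (wave lam).
Proof.
apply: (cintegrable_le (ccont_cmeas (wave_ccont lam))
  (cintegrable_cabs (phik_cintegrable 0))) => t; by rewrite cabs_wave.
Qed.

Lemma fourier_wave lam u : fourier (wave lam) u = cofR (psi (u - lam)).
Proof.
rewrite -fourier_phi0; apply: eq_cint => t; rewrite /wave mulrAC -expiD mulrC.
by congr (_ * expi _); ring.
Qed.

Lemma ifourier_shift lam r :
  ifourier (fun v => cofR (psi (v - lam))) r = wave lam r.
Proof.
rewrite /wave /phik psik0 /ifourier mulrCA; congr (_ * _).
have ip : rintegrable psi by have := psik_rintegrable 0; rewrite psik0.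
rewrite -cintZ; last exact: cintegrable_cofR_expi.
set G := (fun u => expi (lam * r) * _).
have cG : ccont G.
  apply: ccontM; first exact: ccont_cst.
  apply: ccontM; first by apply: ccont_cofR; exact: psi_continuous.
  apply: ccont_comp; first exact: ccont_expi.
  by move=> t; apply: cvgMl_tmp; exact: cvg_id.
have iG : cintegrable G by apply: cintegrableZ; exact: cintegrable_cofR_expi.
have [_ <-] := cint_shift (- lam) cG iG; apply: eq_cint => v.
by rewrite /G mulrCA -expiD; congr (_ * expi _); ring.
Qed.

Lemma psik_even m t : psik psi m.*2%:Z t = psi (t / 4 ^+ m).
Proof.
rewrite /psik; congr psi; rewrite mulrC; congr (_ * _).
by rewrite -exprnN -mul2n exprM; congr (_ ^- _); ring.
Qed.

Lemma psik_odd m t : psik psi m.*2.+1%:Z t = psi (t / 4 ^+ m / 2).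
Proof.
rewrite /psik; congr psi; rewrite mulrC -mulrA; congr (_ * _).
have e4 : 2 ^+ 2 = 4 :> R by ring.
by rewrite -exprnN exprS -mul2n exprM e4 invfM mulrC.
Qed.

(** Since [4^l >= 4], the interval [[4^l + 1/2, 4^l + 2]] lies in [[4^l, 2 * 4^l]], where the pair
    with [k = l] sums to 1. If [k > l] it lies below [4^k / 2], and if [k < l] above [4 * 4^k],
    outside the supports of both multipliers. *)
Lemma psik_pair_wave (k l : nat) v : (0 < k)%N -> (0 < l)%N ->
  (psik psi k.*2%:Z v + psik psi k.*2.+1%:Z v) * psi (v - 4 ^+ l) =
  if k == l then psi (v - 4 ^+ l) else 0.
Proof.
move=> k0 l0; rewrite psik_even psik_odd.
have [h|h] := boolP (2^-1 <= v - 4 ^+ l <= 2); last first.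
  have -> : psi (v - 4 ^+ l) = 0.
    apply: psi_supp; move: h; rewrite negb_and -!ltNge => /orP[]; by [left|right].
  by rewrite mulr0 if_same.
have p4 (m : nat) : 0 < 4 ^+ m :> R by rewrite exprn_gt0.
have l4 : 4 <= 4 ^+ l :> R by rewrite -[leLHS]expr1 ler_eXn2l// ltr1n.
case/andP: h => h1 h2.
have [->|kl] := eqVneq k l.
  have [_ [_ [_ ->]]] := psiP; first by rewrite mul1r.
  rewrite ler_pdivlMr// ler_pdivrMr//; apply/andP; split; lra.
case: (ltngtP k l) kl => // kl _.
  have h4 : 4 * 4 ^+ k <= 4 ^+ l :> R by rewrite -exprS ler_eXn2l// ltr1n.
  rewrite (@psi_supp (v / 4 ^+ k)) ?(@psi_supp (v / 4 ^+ k / 2)) ?addr0 ?mul0r//;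
    by right; rewrite !ltr_pdivlMr//; have := p4 k; lra.
have h4 : 4 * 4 ^+ l <= 4 ^+ k :> R by rewrite -exprS ler_eXn2l// ltr1n.
rewrite (@psi_supp (v / 4 ^+ k)) ?(@psi_supp (v / 4 ^+ k / 2)) ?addr0 ?mul0r//;
  by left; rewrite !ltr_pdivrMr//; have := p4 k; lra.
Qed.

Lemma conv_phik_wave (k l : nat) r : (0 < k)%N -> (0 < l)%N ->
  conv (phik psi k.*2%:Z) (wave (4 ^+ l)) r +
  conv (phik psi k.*2.+1%:Z) (wave (4 ^+ l)) r =
  if k == l then wave (4 ^+ l) r else 0.
Proof.
move=> k0 l0; have [M HM] := psi_bounded.
have cs : continuous (fun v : R => psi (v - 4 ^+ l)).
  move=> v; apply: (@continuous_comp _ _ _ (fun v : R => v - 4 ^+ l) psi).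
    by apply: cvgB; [exact: cvg_id|exact: cvg_cst].
  exact: psi_continuous.
have bs v : `|psi (v - 4 ^+ l)| <= M by [].
rewrite /phik !(conv_ifourier _ (@psik_continuous _) (psik_rintegrable _)
  (wave_cintegrable _) cs bs (fourier_wave _)).
have ig k' : rintegrable (fun v => psik psi k' v * psi (v - 4 ^+ l)).
  apply: (rintegrable_le _ (rintegrableZ M (rintegrable_norm (psik_rintegrable k')))).
    apply: continuous_measurable_fun => v.
    by apply: cvgM; [exact: psik_continuous|exact: cs].
  by move=> v; rewrite normrM mulrC ler_wpM2r.
rewrite /ifourier -mulrDr -cintD; [|exact: cintegrable_cofR_expi..].
transitivity (ifourier (fun v => cofR (if k == l then psi (v - 4 ^+ l) else 0)) r).
  rewrite /ifourier; congr (_ * _); apply: eq_cint => v.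
  by rewrite -mulrDl -cofRD -mulrDl psik_pair_wave.
case: eqP => _; first exact: ifourier_shift.
rewrite /ifourier; under eq_fun do rewrite cofR0 mul0r.
by rewrite cint0 mulr0.
Qed.

End admissible.

(** * The L^1 norm of lacunary blocks *)

Section lacunary_blocks.
Context {R : realType}.

Lemma rintegrable_lorentz_cos (u : R) :
  rintegrable (fun t => lorentz t * cos (t * u)).
Proof.
apply: (rintegrable_le _ rintegrable_lorentz) => [|t].
  apply: continuous_measurable_fun => t; apply: cvgM; first exact: continuous_lorentz.
  apply: (@continuous_comp _ _ _ (fun t : R => t * u) cos).
    by apply: cvgMr_tmp; exact: cvg_id.
  exact: continuous_cos.
rewrite normrM (ger0_norm (ltW (lorentz_gt0 _))) ler_piMr ?(ltW (lorentz_gt0 _))//.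
exact: cos_max.
Qed.

(** Inversion applied to [abel 1]: its inverse transform is [lorentz / pi], whose Fourier transform
    must be [abel 1] again. *)
Lemma rint_lorentz_cos (u : R) :
  rint (fun t => lorentz t * cos (t * u)) = pi * expR (- `|u|).
Proof.
have pi0 : 0 < pi :> R by exact: pi_gt0.
have [ia _] := rint_abel (@ltr01 R).
have E : ifourier (fun v => cofR (abel 1 v)) =
    fun t : R => cofR (pi^-1 * lorentz t).
  apply/funext => t; rewrite /ifourier.
  under eq_cint do rewrite (mulrC t).
  rewrite cint_abel// -cofRM; congr cofR; rewrite expr1n mulr1 /lorentz.
  move: (pi : R) pi0 => p p0; have := lorentz_den t => h; field.
  by rewrite !gt_eqF.
have H : fourier (fun t : R => cofR (pi^-1 * lorentz t)) u = cofR (abel 1 u).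
  rewrite -E; apply: (@fourier_ifourier _ (abel 1) 1) => //.
  - exact: continuous_abel.
  - by move=> t; rewrite -cabs_cofR cabs_abel.
  rewrite E; apply: cintegrable_cofR; apply: rintegrableZ; exact: rintegrable_lorentz.
have ic := rintegrable_lorentz_cos u.
move/(congr1 (@cRe R)): H => /=; rewrite -/(rint _) /abel mul1r => <-.
rewrite -rintZ; last first.
  by have := rintegrableZ pi^-1 ic; congr rintegrable; apply/funext => t;
    rewrite cosN mul0r subr0 mulrA.
apply: eq_rint => t; rewrite cosN mul0r subr0 !mulrA divff ?mul1r//.
by rewrite gt_eqF.
Qed.

(** Used with [N = 4^j] and [i < N]: the exponents of block [j] fill [4^j <= k < 2 * 4^j], and these
    ranges are disjoint for different [j]. *)
Definition freq (N i : nat) : R := 4 ^+ (N + i).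

(** Consecutive frequencies grow by a factor 4, so a gap is at least three times the smaller one,
    itself at least [4^N >= N]. This crude bound is all that the off-diagonal terms require. *)
Lemma freq_gap (N i j : nat) : i != j -> N%:R <= `|freq N i - freq N j|.
Proof.
wlog ij : i j / (i < j)%N => [H|_].
  case: (ltngtP i j) => // h _; first by apply: H; rewrite ?ltn_eqF.
  by rewrite distrC; apply: H; rewrite ?ltn_eqF.
rewrite distrC ger0_norm; last first.
  by rewrite subr_ge0 ler_eXn2l ?ltr1n// leq_add2l ltnW.
have h1 : N%:R <= freq N i.
  by rewrite /freq -natrX ler_nat (leq_trans (leq_addr i N))// ltnW// ltn_expl.
have h2 : 4 * freq N i <= freq N j.
  by rewrite /freq -exprS ler_eXn2l ?ltr1n// -addnS leq_add2l.
have h3 : 0 <= N%:R :> R by [].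
by lra.
Qed.

Lemma cabs_sum_expi (N : nat) (t : R) :
  cabs (\sum_(i < N) expi (freq N i * t)) ^+ 2 =
  \sum_(i < N) \sum_(j < N) cos (t * (freq N i - freq N j)).
Proof.
rewrite cabs_sqr cRe_sum cIm_sum !expr2 !big_distrlr/= -big_split/=.
apply: eq_bigr => i _; rewrite -big_split/=; apply: eq_bigr => j _.
by rewrite mulrBr cosB mulrC; congr (_ + _); rewrite ?(mulrC t) // mulrC.
Qed.

(** Near orthogonality for the weight [lorentz]: in the expanded square each row has a diagonal term
    [pi] and fewer than [N] others, each at most [pi * exp (- gap) <= pi / N]. A row thus costs at
    most [2 * pi]. *)
Lemma rint_sum_expi (N : nat) : (0 < N)%N ->
  rintegrable (fun t => lorentz t * cabs (\sum_(i < N) expi (freq N i * t)) ^+ 2) /\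
  rint (fun t => lorentz t * cabs (\sum_(i < N) expi (freq N i * t)) ^+ 2) <=
  2 * pi * N%:R.
Proof.
move=> N0.
have E : (fun t => lorentz t * cabs (\sum_(i < N) expi (freq N i * t)) ^+ 2) =
  fun t => \sum_(i < N) \sum_(j < N) lorentz t * cos (t * (freq N i - freq N j)).
  by apply/funext => t; rewrite cabs_sum_expi mulr_sumr; apply: eq_bigr => i _;
    rewrite mulr_sumr.
have ic := rintegrable_lorentz_cos.
rewrite E; split; first by do 2! apply: rintegrable_sum => ?; exact: ic.
rewrite rint_sum; last by move=> i; apply: rintegrable_sum => j; exact: ic.
have N0' : 0 < N%:R :> R by rewrite ltr0n.
rewrite (_ : 2 * pi * N%:R = \sum_(i < N) (2 * pi)); last first.
  by rewrite sumr_const card_ord mulr_natr.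
apply: ler_sum => i _; rewrite rint_sum; last by move=> j; exact: ic.
rewrite (bigD1 i)//= rint_lorentz_cos subrr normr0 oppr0 expR0 mulr1.
rewrite mulr_natl mulr2n lerD2l.
apply: (@le_trans _ _ (\sum_(j < N | j != i) (pi / N%:R))).
  apply: ler_sum => j ji; rewrite rint_lorentz_cos ler_pM2l ?pi_gt0//.
  rewrite expRN lef_pV2 ?posrE ?expR_gt0//.
  have h : N%:R <= `|freq N i - freq N j| by apply: freq_gap; rewrite eq_sym.
  by rewrite (le_trans h)// (le_trans _ (expR_ge1Dx _))// lerDr.
apply: (@le_trans _ _ (\sum_(j < N) (pi / N%:R))).
  by rewrite [leRHS](bigD1 i)//= lerDr divr_ge0 ?pi_ge0//.
by rewrite sumr_const card_ord -[_ *+ N]mulr_natr divfK// gt_eqF.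
Qed.

Variable psi : R -> R.
Hypothesis psiP : admissible_psi psi.

Definition block (j : nat) (t : R) : R[i] :=
  \sum_(i < 4 ^ j) wave psi (freq (4 ^ j) i) t.

Lemma block_ccont j : ccont (block j).
Proof. by apply: ccont_sum => i; exact: wave_ccont. Qed.

Lemma block_cintegrable j : cintegrable (block j).
Proof. by apply: cintegrable_sum => i; exact: wave_cintegrable. Qed.

(* AM-GM in the form 2 |p| <= 2^j + |p|^2 / 2^j replaces the Cauchy-Schwarz
   inequality: the block has 4^j frequencies, so its weighted L^2 norm is O(2^j). *)
Lemma L1norm_block : exists2 K : R, 0 < K & forall j, L1norm (block j) <= K * 2 ^+ j.
Proof.
have [C C0 HC] := phik_decay psiP 0.
exists (C * (3 / 2 * pi)) => [|j]; first by rewrite !mulr_gt0 ?pi_gt0// invr_gt0.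
set N := (4 ^ j)%N; have N0 : (0 < N)%N by rewrite expn_gt0.
pose p (t : R) := cabs (\sum_(i < N) expi (freq N i * t)).
have [ip lep] := rint_sum_expi N0.
have s0 : 0 < 2 ^+ j :> R by rewrite exprn_gt0.
have NE : N%:R = 2 ^+ j * 2 ^+ j :> R by rewrite -exprMn natrX; congr (_ ^+ _); ring.
pose g (t : R) := C * (2 ^+ j / 2 * lorentz t + (2 * 2 ^+ j)^-1 * (lorentz t * p t ^+ 2)).
have i1 : rintegrable (fun t : R => 2 ^+ j / 2 * lorentz t).
  exact: (rintegrableZ (2 ^+ j / 2) rintegrable_lorentz).
have i2 : rintegrable (fun t => (2 * 2 ^+ j)^-1 * (lorentz t * p t ^+ 2)).
  exact: (rintegrableZ (2 * 2 ^+ j)^-1 ip).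
have i3 := rintegrableD i1 i2.
apply: (@le_trans _ _ (rint g)).
  apply: le_rint.
  - by apply: cintegrable_cabs; exact: block_cintegrable.
  - exact: (rintegrableZ C i3).
  - move=> t; rewrite /block /wave -mulr_suml cabsM -/(p t).
    apply: (@le_trans _ _ (p t * (C * lorentz t))).
      by rewrite ler_wpM2l ?cabs_ge0.
    rewrite mulrCA /g ler_pM2l//.
    have -> : 2 ^+ j / 2 * lorentz t + (2 * 2 ^+ j)^-1 * (lorentz t * p t ^+ 2) =
      lorentz t * (2 ^+ j / 2 + (2 * 2 ^+ j)^-1 * p t ^+ 2) by ring.
    rewrite [p t * _]mulrC.
    rewrite ler_pM2l ?lorentz_gt0// -subr_ge0.
    have -> : 2 ^+ j / 2 + (2 * 2 ^+ j)^-1 * p t ^+ 2 - p t =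
      (2 ^+ j - p t) ^+ 2 / (2 * 2 ^+ j) by field; rewrite gt_eqF.
    by rewrite divr_ge0 ?sqr_ge0// mulr_ge0// ltW.
rewrite rintZ// rintD// rintZ ?rintZ//; last exact: rintegrable_lorentz.
rewrite rint_lorentz -mulrA ler_pM2l//.
have : (2 * 2 ^+ j)^-1 * rint (fun t => lorentz t * p t ^+ 2) <= pi * 2 ^+ j.
  rewrite ler_pdivrMl ?mulr_gt0//; apply: le_trans lep _; rewrite NE.
  by rewrite le_eqVlt; apply/orP; left; apply/eqP; ring.
by lra.
Qed.

(** For [u <= 0] and a positive frequency [lam], the argument of [psi (u - lam)] is negative, hence
    off the support. *)
Lemma block_H1 j : H1 (block j).
Proof.
split; first exact: block_cintegrable.
move=> u u0; rewrite /fourier /block.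
under eq_cint do rewrite mulr_suml.
rewrite cint_sum => [|i].
  apply: big1 => i _; rewrite -/(fourier _ _) fourier_wave// psi_supp//; left.
  have : 0 < freq (4 ^ j) i by rewrite exprn_gt0.
  by have : 0 < 2^-1 :> R by []; lra.
apply: (@eq_cintegrable _ (fun t => expi (- (t * u)) * wave psi (freq (4 ^ j) i) t)).
  by move=> t; rewrite mulrC.
apply: (@cintegrableM_bounded _ _ _ 1); last exact: wave_cintegrable.
  apply: cmeas_comp; first exact: ccont_expi.
  by apply: measurableT_comp => //; exact: measurable_funM.
by move=> t; rewrite cabs_expi.
Qed.

End lacunary_blocks.

(** * The damped chirp: regularity and a lower bound at the peaks *)

Section chirp.
Context {R : realType}.

Definition chirp (a q x : R) : R[i] := expi (a * x ^+ 2) * cofR (lorentz (q * x)).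

Lemma lorentz_le1 (x : R) : lorentz x <= 1.
Proof. by rewrite invf_le1 ?lorentz_den// lerDl sqr_ge0. Qed.

Lemma lorentz0 : lorentz 0 = 1 :> R.
Proof. by rewrite /lorentz expr0n addr0 invr1. Qed.

Lemma cabs_chirp a q x : cabs (chirp a q x) = lorentz (q * x).
Proof. by rewrite cabsM cabs_expi mul1r cabs_cofR gtr0_norm// lorentz_gt0. Qed.

Lemma cabs_chirp_le1 a q x : cabs (chirp a q x) <= 1.
Proof. by rewrite cabs_chirp lorentz_le1. Qed.

Lemma continuous_sq (a : R) : continuous (fun x : R => a * x ^+ 2).
Proof. by move=> x; apply: cvgMl_tmp; exact: exprn_continuous. Qed.

Lemma continuous_lorentz_affine (q x : R) : continuous (fun t => lorentz (q * (x - t))).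
Proof.
move=> t; apply: (@continuous_comp _ _ _ (fun t : R => q * (x - t)) lorentz).
  by apply: cvgMl_tmp; apply: cvgB; [exact: cvg_cst|exact: cvg_id].
exact: continuous_lorentz.
Qed.

Lemma chirp_ccont a q : ccont (chirp a q).
Proof.
apply: ccontM; first by apply: ccont_comp; [exact: ccont_expi|exact: continuous_sq].
apply: ccont_cofR => x; apply: (@continuous_comp _ _ _ (fun t : R => q * t) lorentz).
  by apply: cvgMl_tmp; exact: cvg_id.
exact: continuous_lorentz.
Qed.

Section bounds.
Variables (a q : R).
Hypotheses (a0 : 0 < a) (q0 : 0 < q).

(** From [2 |q x| <= 1 + (q x)^2]. This tames the unbounded derivative [2 a x] of the phase and
    makes the damped chirp Lipschitz. *)
Let slope (x : R) : `|2 * x * lorentz (q * x)| <= q^-1.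
Proof.
rewrite normrM (gtr0_norm (lorentz_gt0 _)) ler_pdivrMr ?lorentz_den//.
rewrite ler_pdivlMl// normrM (ger0_norm (ler0n _ 2)).
have -> : q * (2 * `|x|) = 2 * `|q * x| by rewrite normrM (gtr0_norm q0); ring.
have := sqr_ge0 (1 - `|q * x|); rewrite sqrrB expr1n real_normK ?num_real// mul1r.
by rewrite mulr2n; lra.
Qed.

Let d_lorentz (x : R) : is_derive x (1 : R) (fun x => lorentz (q * x))
  (- (q ^+ 2 * (2 * x * lorentz (q * x)) * lorentz (q * x))).
Proof.
have h : 1 + (q * x) ^+ 2 != 0 by rewrite gt_eqF// lorentz_den.
rewrite /lorentz; apply: is_derive_eq; rewrite /GRing.scale/=.
by field.
Qed.

(** Serves the real and the imaginary part together, [u] and [v] being a sine or cosine up to sign.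
    The first term is at most [a * q^-1], the second at most [q^2 * q^-1 * 1]. *)
Let bound (u v x : R) : `|u| <= 1 -> `|v| <= 1 ->
  `|u * (a * (2 * x * lorentz (q * x))) -
    v * (q ^+ 2 * (2 * x * lorentz (q * x)) * lorentz (q * x))| <= a / q + q.
Proof.
move=> u1 v1; have s := slope x.
have l0 := lorentz_gt0 (q * x); have l1 := lorentz_le1 (q * x).
rewrite (le_trans (ler_normB _ _))// lerD//.
  rewrite normrM normrM (gtr0_norm a0) -[leRHS]mul1r ler_pM// ?mulr_ge0 ?(ltW a0)//.
  by rewrite ler_pM2l.
have qn0 : q != 0 by rewrite gt_eqF.
rewrite [leRHS](_ : q = 1 * (q ^+ 2 * q^-1 * 1)); last by field.
rewrite normrM ler_pM// normrM ler_pM//; last by rewrite gtr0_norm.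
by rewrite normrM ger0_norm ?sqr_ge0// ler_pM2l// exprn_gt0.
Qed.

Lemma chirp_unif : cunif_continuous (chirp a q).
Proof.
pose K := a / q + q.
have K0 : 0 < K by rewrite addr_gt0// divr_gt0.
have lipRe x y : `|cRe (chirp a q x) - cRe (chirp a q y)| <= K * `|x - y|.
  apply: (@is_derive_lipschitz _ (fun x => cRe (chirp a q x)) (fun x =>
    (- sin (a * x ^+ 2)) * (a * (2 * x * lorentz (q * x))) -
    cos (a * x ^+ 2) * (q ^+ 2 * (2 * x * lorentz (q * x)) * lorentz (q * x)))).
    move=> z; rewrite (_ : (fun x => _) =
      fun x => cos (a * x ^+ 2) * lorentz (q * x)); last first.
      by apply/funext => w /=; ring.
    have d1 : is_derive z (1 : R) (fun x => cos (a * x ^+ 2)) (- sin (a * z ^+ 2) * (a * (2 * z))).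
      by apply: is_derive_eq; rewrite /GRing.scale/=; ring.
    have := is_deriveM d1 (d_lorentz z); rewrite /GRing.scale/= => d2.
    by apply: (@is_derive_eq _ _ _ _ _ _ _ _ d2); ring.
  by move=> z; apply: bound; rewrite ?normrN ?sin_max ?cos_max.
have lipIm x y : `|cIm (chirp a q x) - cIm (chirp a q y)| <= K * `|x - y|.
  apply: (@is_derive_lipschitz _ (fun x => cIm (chirp a q x)) (fun x =>
    cos (a * x ^+ 2) * (a * (2 * x * lorentz (q * x))) -
    sin (a * x ^+ 2) * (q ^+ 2 * (2 * x * lorentz (q * x)) * lorentz (q * x)))).
    move=> z; rewrite (_ : (fun x => _) =
      fun x => sin (a * x ^+ 2) * lorentz (q * x)); last first.
      by apply/funext => w /=; ring.
    have d1 : is_derive z (1 : R) (fun x => sin (a * x ^+ 2)) (cos (a * z ^+ 2) * (a * (2 * z))).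
      by apply: is_derive_eq; rewrite /GRing.scale/=; ring.
    have := is_deriveM d1 (d_lorentz z); rewrite /GRing.scale/= => d2.
    by apply: (@is_derive_eq _ _ _ _ _ _ _ _ d2); ring.
  by move=> z; apply: bound; rewrite ?sin_max ?cos_max.
move=> e e0; exists (e / (2 * K)) => [|s t]; first by rewrite divr_gt0// mulr_gt0.
rewrite ltr_pdivlMr ?mulr_gt0// => st.
rewrite (le_lt_trans (cabs_leD _))// !cE.
by have := lipRe s t; have := lipIm s t; lra.
Qed.

Lemma chirp_vanishes (e : R) : 0 < e ->
  exists M : R, forall t, M < `|t| -> cabs (chirp a q t) < e.
Proof.
(* Beyond this radius [|q t| > 1/e + 1 > 1], so that [(q t)^2 >= |q t| > 1/e]. *)
move=> e0; exists (e^-1 / q + q^-1) => t ht.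
rewrite cabs_chirp invf_plt ?posrE ?lorentz_den//.
have h : e^-1 + 1 < `|q * t|.
  rewrite normrM (gtr0_norm q0) mulrC -ltr_pdivrMr//.
  by apply: le_lt_trans ht; rewrite mulrDl mul1r.
rewrite -real_normK ?num_real//.
have eV : 0 < e^-1 by rewrite invr_gt0.
have : `|q * t| <= `|q * t| ^+ 2 by rewrite expr2 ler_peMl//; lra.
by lra.
Qed.

End bounds.

Variable psi : R -> R.
Hypothesis psiP : admissible_psi psi.

(** What is left of chirp times wave at the peak, without the damping and a unimodular constant; it
    does not involve [lam]. At [a = 0] its integral is the transform of [phik psi 0] at 1, that is
    [psi 1]. *)
Let profile (a t : R) : R[i] := expi (a * t ^+ 2) * (expi (- t) * phik psi 0 t).

Let profile_ccont a : ccont (profile a).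
Proof.
apply: ccontM; first by apply: ccont_comp; [exact: ccont_expi|exact: continuous_sq].
apply: ccontM; last exact: phik_ccont.
apply: ccont_comp; first exact: ccont_expi.
by move=> t; apply: cvgN; exact: cvg_id.
Qed.

Let cabs_profile a t : cabs (profile a t) = cabs (phik psi 0 t).
Proof. by rewrite !cabsM !cabs_expi !mul1r. Qed.

Let profile_cintegrable a : cintegrable (profile a).
Proof.
apply: (cintegrable_le (ccont_cmeas (profile_ccont a))
  (cintegrable_cabs (phik_cintegrable psiP 0))) => t; by rewrite cabs_profile.
Qed.

Let cint_profile : (fun n => cabs (cint (profile n.+1%:R^-1) - 1)) @ \oo --> (0 : R).
Proof.
pose limit t := expi (- t) * phik psi 0 t.
have limitE : profile 0 = limit.
  by apply/funext => t; rewrite /profile mul0r expi0 mul1r.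
have -> : 1 = cint limit.
  have := fourier_phi0 psiP 1; rewrite (psi_1 psiP) cofR1 => <-.
  by apply: eq_cint => t; rewrite mulr1 mulrC.
apply: (cint_dominated (b := fun t => cabs (phik psi 0 t))).
- by move=> n; apply: ccont_cmeas; exact: profile_ccont.
- by rewrite -limitE; apply: ccont_cmeas; exact: profile_ccont.
- by apply: cintegrable_cabs; exact: phik_cintegrable.
- by move=> n t; rewrite cabs_profile.
- by move=> t; rewrite -limitE cabs_profile.
- move=> t; rewrite /profile -/(limit t).
  under eq_fun do rewrite -{2}[limit t]mul1r -mulrBl cabsM.
  rewrite -(mul0r (cabs (limit t))); apply: cvgMr_tmp.
  have := @cvg_cabs_seq _ (fun y => expi (y * t ^+ 2)) 0 _ _ cvg_invn.
  rewrite mul0r expi0; apply.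
  apply: ccont_comp; first exact: ccont_expi.
  by move=> y; apply: cvgMr_tmp; exact: cvg_id.
Qed.

(* At [x = (lam + 1) / (2 a)] the derivative of the phase [a (x - t)^2 + lam t]
   at [t = 0] equals [-1], whatever [lam] is. *)
Let conv_chirp_wave (a q lam : R) (x := (lam + 1) / (2 * a)) : 0 < a ->
  cabs (conv (chirp a q) (wave psi lam) x) =
  cabs (cint (fun t => cofR (lorentz (q * (x - t))) * profile a t)).
Proof.
move=> a0.
rewrite -[RHS]mul1r -(cabs_expi (a * x ^+ 2)) -cabsM -cintZ; last first.
  apply: (@cintegrableM_bounded _ _ _ 1) => //.
    apply: cmeas_cofR; apply: continuous_measurable_fun.
    exact: continuous_lorentz_affine.
  by move=> t; rewrite cabs_cofR gtr0_norm ?lorentz_gt0 ?lorentz_le1.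
congr cabs; apply: eq_cint => t; rewrite /chirp /wave /profile.
have : expi (a * (x - t) ^+ 2) * expi (lam * t) =
    expi (a * x ^+ 2) * expi (a * t ^+ 2) * expi (- t).
  rewrite -!expiD; congr expi; rewrite /x; field; by rewrite gt_eqF.
by move=> E; rewrite mulrACA E; ring.
Qed.

(** The order of choices matters: [a] comes first, independent of [N] and of the frequencies, so
    that the integral of the profile has modulus at least [1/2]; then [q] is taken so small that the
    damping costs less than [1/4] at each of the [N] peaks. *)
Lemma chirp_lower : exists2 a : R, 0 < a &
  forall (N : nat) (lam : 'I_N -> R), exists2 q : R, 0 < q &
  forall i, exists x, 4^-1 <= cabs (conv (chirp a q) (wave psi (lam i)) x).
Proof.
have h2 : 0 < 2^-1 :> R by rewrite invr_gt0.
have h4 : 0 < 4^-1 :> R by rewrite invr_gt0.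
have /cvgrPdist_lt/(_ _ h2) H := cint_profile.
near \oo => n0.
have a0 : 0 < n0.+1%:R^-1 :> R by rewrite invr_gt0.
have Ha : 2^-1 <= cabs (cint (profile n0.+1%:R^-1)).
  have : `|0 - cabs (cint (profile n0.+1%:R^-1) - 1)| < 2^-1 by near: n0.
  rewrite sub0r normrN ger0_norm ?cabs_ge0// cabs_distC => h.
  by have := cabs_dist 1 (cint (profile n0.+1%:R^-1)); rewrite cabs1; lra.
move: (n0.+1%:R^-1) a0 Ha => a a0 Ha; exists a => // N lam.
pose x i := (lam i + 1) / (2 * a).
pose I q i := cint (fun t => cofR (lorentz (q * (x i - t))) * profile a t).
have Hn i : \forall n \near \oo, cabs (I n.+1%:R^-1 i - cint (profile a)) < 4^-1.
  suff /cvgrPdist_lt/(_ _ h4) : (fun n => cabs (I n.+1%:R^-1 i - cint (profile a)))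
      @ \oo --> (0 : R).
    apply: filterS => n; by rewrite sub0r normrN ger0_norm ?cabs_ge0.
  apply: (cint_dominated (b := fun t => cabs (phik psi 0 t))).
  - move=> n; apply: cmeasM; last by apply: ccont_cmeas; exact: profile_ccont.
    apply: cmeas_cofR; apply: continuous_measurable_fun.
    exact: continuous_lorentz_affine.
  - by apply: ccont_cmeas; exact: profile_ccont.
  - by apply: cintegrable_cabs; exact: phik_cintegrable.
  - move=> n t; rewrite cabsM cabs_profile ler_piMl ?cabs_ge0//.
    by rewrite cabs_cofR gtr0_norm ?lorentz_gt0 ?lorentz_le1.
  - by move=> t; rewrite cabs_profile.
  - move=> t; under eq_fun do rewrite -{2}[profile a t]mul1r -mulrBl cabsM.
    rewrite -(mul0r (cabs (profile a t))); apply: cvgMr_tmp.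
    have := @cvg_cabs_seq _ (fun y => cofR (lorentz (y * (x i - t)))) 0 _ _ cvg_invn.
    rewrite mul0r lorentz0 cofR1; apply; apply: ccont_cofR => y.
    apply: (@continuous_comp _ _ _ (fun y : R => y * (x i - t)) lorentz).
      by apply: cvgMr_tmp; exact: cvg_id.
    exact: continuous_lorentz.
(* Finiteness of ['I_N] enters here: one damping parameter is good for all the peaks. *)
have Hall : \forall n \near \oo, forall i : 'I_N,
    cabs (I n.+1%:R^-1 i - cint (profile a)) < 4^-1.
  exact: (filter_forall (F := \oo)).
near \oo => n1.
have Hn1 : forall i : 'I_N, cabs (I n1.+1%:R^-1 i - cint (profile a)) < 4^-1.
  by near: n1.
exists n1.+1%:R^-1 => [|i]; first by rewrite invr_gt0.
exists (x i); rewrite conv_chirp_wave// -/(I _ i).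
have := Hn1 i; rewrite cabs_distC => h; have := cabs_dist (cint (profile a)) (I n1.+1%:R^-1 i).
have : 2^-1 = 4^-1 + 4^-1 :> R by field.
by lra.
Unshelve. all: end_near. Qed.

End chirp.

(** * Suprema, geometrically dominated series, symmetric partial sums *)

Section series_and_suprema.
Context {R : realType}.

Lemma cabs_le_supnorm (f : R -> R[i]) (M x : R) : (forall t, cabs (f t) <= M) ->
  cabs (f x) <= supnorm f.
Proof.
move=> fM; apply: ub_le_sup; last by exists x.
by exists M => _ [t _ <-].
Qed.

Lemma supnorm_le (f : R -> R[i]) (M : R) : (forall t, cabs (f t) <= M) ->
  supnorm f <= M.
Proof.
move=> fM; apply: ge_sup; first by exists (cabs (f 0)); exists 0.
by move=> _ [t _ <-].
Qed.

Lemma supnorm_ge0 (f : R -> R[i]) : 0 <= supnorm f.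
Proof.
rewrite /supnorm; have [h|h] := pselect (has_sup (range (fun t => cabs (f t)))).
  rewrite (le_trans (cabs_ge0 (f 0)))//.
  by apply: ub_le_sup; [case: h|exists 0].
(* For an unbounded function [sup] takes the default value 0. *)
by rewrite sup_out.
Qed.

(** The explicit tail is kept along with the limit: applied at each point [x] with the same [K], it
    gives a rate that is uniform in [x]. *)
Lemma geometric_domination (u : nat -> R) (K : R) :
  (forall k, `|u k| <= K * 2 ^- k) -> exists2 l : R,
  (fun n => \sum_(k < n) u k) @ \oo --> l &
  forall n, `|l - \sum_(k < n) u k| <= 2 * K * 2 ^- n.
Proof.
move=> uK.
have SE : (fun n => \sum_(k < n) u k) = series u.
  by apply/funext => n; rewrite /series/= big_mkord.
have h2 : `|2^-1 : R| < 1 by rewrite ger0_norm ?invr_ge0// invf_lt1// ltr1n.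
have cS : cvgn (series u).
  apply: normed_cvg; apply: (series_le_cvg (v_ := geometric K 2^-1)) => [n|n|n|] /=.
  - exact: normr_ge0.
  - by rewrite exprVn (le_trans _ (uK n)).
  - by rewrite exprVn.
  - exact: is_cvg_geometric_series.
exists (limn (series u)); first by rewrite SE.
have K0 : 0 <= K by have := le_trans (normr_ge0 _) (uK 0%N); rewrite expr0 invr1 mulr1.
have p2 m : 0 < 2 ^- m :> R by rewrite invr_gt0 exprn_gt0.
(* The right-hand side is the exact geometric sum of [K * 2^-k] over [n <= k < n + d], so the
   induction telescopes. *)
have tail n d : `|\sum_(k < n + d) u k - \sum_(k < n) u k| <=
    2 * K * (2 ^- n - 2 ^- (n + d)).
  elim: d => [|d IH]; first by rewrite addn0 !subrr normr0 mulr0.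
  rewrite addnS big_ord_recr/= addrAC (le_trans (ler_normD _ _))//.
  have := uK (n + d)%N.
  have -> : 2 ^- (n + d) = 2 * 2 ^- (n + d).+1 :> R.
    by rewrite exprS invfM mulrA divff ?mul1r.
  move: IH; have -> : 2 ^- (n + d) = 2 * 2 ^- (n + d).+1 :> R.
    by rewrite exprS invfM mulrA divff ?mul1r.
  by lra.
move=> n; rewrite leNgt; apply/negP => h.
have e0 : 0 < `|limn (series u) - \sum_(k < n) u k| - 2 * K * 2 ^- n.
  by rewrite subr_gt0.
move/cvgrPdist_lt/(_ _ e0) : cS => cS; near \oo => m.
have : `|limn (series u) - series u m| <
  `|limn (series u) - \sum_(k < n) u k| - 2 * K * 2 ^- n by near: m.
have nm : (n <= m)%N by near: m; exact: nbhs_infty_ge.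
have := tail n (m - n)%N; rewrite subnKC// => t1 t2.
have t3 : 2 * K * (2 ^- n - 2 ^- m) <= 2 * K * 2 ^- n.
  by rewrite ler_wpM2l ?mulr_ge0// gerBl ltW.
have SEm : series u m = \sum_(k < m) u k by rewrite -SE.
rewrite SEm in t2.
have := ler_distD (\sum_(k < m) u k) (limn (series u)) (\sum_(k < n) u k).
by lra.
Unshelve. all: end_near. Qed.

Local Notation zpart := (@zpartial R R).

Lemma zpartialS (b : int -> R) (n : nat) :
  zpart b n.+1 = zpart b n + b n.+1%:Z + b (- n.+1%:Z).
Proof.
rewrite /zpartial doubleS big_ord_recr big_ord_recl/= addrC.
rewrite [RHS]addrAC [RHS]addrC; congr (b _ + _).
  by rewrite -addnn; lia.
rewrite addrC; congr (_ + b _); last by lia.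
by apply: eq_bigr => i _; congr b; rewrite /bump /=; lia.
Qed.

(** A window ending at the odd index [2m + 1] stops just before a complete pair. The negative
    indices also gained by enlarging the window are dropped by positivity. *)
Lemma zpartial_pairs (b : int -> R) (m n : nat) : (forall k, 0 <= b k) ->
  zpart b m.*2.+1 + \sum_(i < n) (b (m.+1 + i).*2%:Z + b (m.+1 + i).*2.+1%:Z) <=
  zpart b (m + n).*2.+1.
Proof.
move=> b0; elim: n => [|n IH]; first by rewrite big_ord0 addr0 addn0.
rewrite big_ord_recr/= addnS addSn doubleS.
have := zpartialS b (m + n).*2.+1; have := zpartialS b (m + n).*2.+2.
have := b0 (- (m + n).*2.+2%:Z); have := b0 (- (m + n).*2.+3%:Z).
by move: IH; lra.
Qed.

End series_and_suprema.

(** * The function in [A0space] and the divergence of its Besov norm *)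

Section counterexample.
Context {R : realType}.
Local Notation zpart := (@zpartial R R).
Variables (psi : R -> R) (a : R) (q : nat -> R) (K : R).
Hypotheses (psiP : admissible_psi psi) (a0 : 0 < a) (q0 : forall j, 0 < q j).
Hypothesis lower : forall j (i : 'I_(4 ^ j)),
  exists x, 4^-1 <= cabs (conv (chirp a (q j)) (wave psi (freq (4 ^ j) i)) x).
Hypothesis normB : forall j, L1norm (block psi j) <= K * 2 ^+ j.

Let f (j : nat) (x : R) : R[i] := cofR (4 ^- j) * chirp a (q j) x.
Let G j : R -> R[i] := conv (f j) (block psi j).

Let p4 j : 0 < 4 ^- j :> R. Proof. by rewrite invr_gt0 exprn_gt0. Qed.

Let K0 : 0 <= K.
Proof. by have := le_trans (L1norm_ge0 _) (normB 0); rewrite expr0 mulr1. Qed.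

Let f_bound j x : cabs (f j x) <= 4 ^- j.
Proof.
by rewrite cabsM cabs_cofR gtr0_norm// ler_piMr ?(ltW (p4 _)) ?cabs_chirp_le1.
Qed.

Let f_ccont j : ccont (f j).
Proof. by apply: ccontM; [exact: ccont_cst|exact: chirp_ccont]. Qed.

Let f_unif j : cunif_continuous (f j).
Proof.
move=> e e0; have e1 : 0 < e / 4 ^- j by rewrite divr_gt0.
have [d d0 H] := chirp_unif a0 (q0 j) e1; exists d => // s t st.
rewrite -mulrBr cabsM cabs_cofR gtr0_norm// mulrC -ltr_pdivlMr//.
exact: H.
Qed.

Let f_C0 j : C0fun (f j).
Proof.
split; first exact/ccontP.
move=> e e0; have e1 : 0 < e / 4 ^- j by rewrite divr_gt0.
have [M H] := chirp_vanishes a (q0 j) e1; exists M => t Mt.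
by rewrite cabsM cabs_cofR gtr0_norm// mulrC -ltr_pdivlMr//; exact: H.
Qed.

Let block_int j := block_cintegrable psiP j.

Let geom j : 4 ^- j * (K * 2 ^+ j) = K * 2 ^- j.
Proof.
have -> : 4 ^+ j = 2 ^+ j * 2 ^+ j :> R by rewrite -exprMn; congr (_ ^+ _); ring.
have h : 2 ^+ j != 0 :> R by rewrite gt_eqF// exprn_gt0.
by field.
Qed.

Let G_bound j x : cabs (G j x) <= K * 2 ^- j.
Proof.
rewrite -geom (le_trans (cabs_conv _ (f_ccont j) (f_bound j) (block_int j)))//.
by rewrite ler_pM2l.
Qed.

Let G_ccont j : ccont (G j).
Proof. exact: (ccont_conv (f_ccont j) (@f_unif j) (f_bound j) (block_int j)). Qed.

Let norms_cvg : rseries_cvg (fun k => supnorm (f k) * L1norm (block psi k)).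
Proof.
have [k|l Hl _] := @geometric_domination _
  (fun k => supnorm (f k) * L1norm (block psi k)) K; last by exists l.
rewrite ger0_norm; last by rewrite mulr_ge0 ?supnorm_ge0 ?L1norm_ge0.
by rewrite -geom ler_pM ?supnorm_ge0 ?L1norm_ge0//; exact: supnorm_le.
Qed.

(** The tail constant [4 * K] collects [2 * K] from each of the real and imaginary parts. *)
Let sum_ex : forall x, exists z : R[i], cseries_to (fun j => G j x) z /\
  forall n, cabs (z - \sum_(j < n) G j x) <= 4 * K * 2 ^- n.
Proof.
move=> x.
have [k|l1 c1 t1] := @geometric_domination _ (fun j => cRe (G j x)) K.
  exact: le_trans (cRe_le _) (G_bound _ _).
have [k|l2 c2 t2] := @geometric_domination _ (fun j => cIm (G j x)) K.
  exact: le_trans (cIm_le _) (G_bound _ _).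
exists (Complex l1 l2); split=> // n.
rewrite (le_trans (cabs_leD _))// !cE cRe_sum cIm_sum /=.
by have := t1 n; have := t2 n; lra.
Qed.

Section sum.
Variable F : R -> R[i].
Hypothesis FE : forall x, cseries_to (fun j => G j x) (F x) /\
  forall n, cabs (F x - \sum_(j < n) G j x) <= 4 * K * 2 ^- n.

Let S n x := \sum_(j < n) G j x.

Let S_ccont n : ccont (S n).
Proof. by apply: ccont_sum => j; exact: G_ccont. Qed.

Let F_bound x : cabs (F x) <= 4 * K.
Proof. by have [_ /(_ 0%N)] := FE x; rewrite big_ord0 subr0 expr0 invr1 mulr1. Qed.

Let S_bound n x : cabs (S n x) <= 8 * K.
Proof.
have [_ /(_ n) h] := FE x; have := F_bound x.
have := cabsB (F x) (F x - S n x).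
have -> : F x - (F x - S n x) = S n x by ring.
have : 4 * K * 2 ^- n <= 4 * K.
  by rewrite ler_piMr ?mulr_ge0// invf_le1 ?exprn_gt0// exprn_ege1// ler1n.
by move: h; rewrite -/(S n x); lra.
Qed.

Let tail_cvg (c : R) : (fun n : nat => c * 2 ^- n) @ \oo --> (0 : R).
Proof.
rewrite -[X in _ --> X](mulr0 c); apply: cvgMl_tmp.
under eq_fun do rewrite -exprVn; apply: cvg_expr.
by rewrite ger0_norm ?invr_ge0// invf_lt1// ltr1n.
Qed.

Let F_ccont : ccont F.
Proof.
apply/ccontP => x e e0.
have e3 : 0 < e / 3 by rewrite divr_gt0.
have /cvgrPdist_lt/(_ _ e3) H := tail_cvg (4 * K).
near \oo => n.
have hn : 4 * K * 2 ^- n < e / 3.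
  have : `|0 - 4 * K * 2 ^- n| < e / 3 by near: n.
  by rewrite sub0r normrN; exact: le_lt_trans (ler_norm _).
have /ccontP/(_ x _ e3)[d d0 Hd] := S_ccont n; exists d => // t xt.
have := Hd t xt; have [_ /(_ n) h1] := FE x; have [_ /(_ n) h2] := FE t.
have -> : F x - F t = (F x - S n x) + (S n x - S n t) - (F t - S n t) by ring.
have := cabsB (F x - S n x + (S n x - S n t)) (F t - S n t).
have := cabsD (F x - S n x) (S n x - S n t).
by rewrite /S in h1 h2 *; lra.
Unshelve. all: end_near. Qed.

Let Phi (k : nat) (t : R) : R[i] := phik psi k.*2%:Z t + phik psi k.*2.+1%:Z t.

Let Phi_ccont k : ccont (Phi k).
Proof. by apply: ccontD; exact: phik_ccont. Qed.

Let Phi_int k : cintegrable (Phi k).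
Proof. by apply: cintegrableD; exact: phik_cintegrable. Qed.

Let Phi_bound k : exists N : R, forall t, cabs (Phi k t) <= N.
Proof.
have [N1 H1] := phik_bounded psiP k.*2%:Z.
have [N2 H2] := phik_bounded psiP k.*2.+1%:Z.
by exists (N1 + N2) => t; rewrite (le_trans (cabsD _ _))// lerD.
Qed.

Let Phi_wave k l r : (0 < k)%N -> (0 < l)%N ->
  conv (Phi k) (wave psi (4 ^+ l)) r = if k == l then wave psi (4 ^+ l) r else 0.
Proof.
move=> k0 l0; rewrite -conv_phik_wave// /conv -cintD.
- by apply: eq_cint => t; rewrite mulrDl.
- have [N H] := phik_bounded psiP k.*2%:Z.
  exact: cintegrable_conv (phik_ccont psiP _) H (wave_cintegrable psiP _).
- have [N H] := phik_bounded psiP k.*2.+1%:Z.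
  exact: cintegrable_conv (phik_ccont psiP _) H (wave_cintegrable psiP _).
Qed.

(** An index determines its block: if [j < J] then [4^j + i' < 2 * 4^j < 4^J], and symmetrically. So
    at most one wave of one block survives. *)
Let Phi_block J (i : 'I_(4 ^ J)) j r :
  conv (Phi (4 ^ J + i)) (block psi j) r =
  if j == J then wave psi (freq (4 ^ J) i) r else 0.
Proof.
have pos m n : (0 < 4 ^ m + n)%N by rewrite addn_gt0 expn_gt0.
have [N HN] := Phi_bound (4 ^ J + i).
transitivity (\sum_(i' < 4 ^ j) conv (Phi (4 ^ J + i)) (wave psi (freq (4 ^ j) i')) r).
  rewrite -cint_sum; last first.
    move=> i'; exact: cintegrable_conv (Phi_ccont _) HN (wave_cintegrable psiP _).
  by apply: eq_cint => t; rewrite /block mulr_sumr.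
under eq_bigr do rewrite Phi_wave//.
case: eqP => [->|/eqP jJ].
  rewrite (bigD1 i)//= eqxx big1 ?addr0// => i' ii'.
  by rewrite eqn_add2l eq_sym (negbTE (_ : i' != i :> nat)).
apply: big1 => i' _; case: eqP => // E; exfalso.
have hi := ltn_ord i; have hi' := ltn_ord i'.
case: (ltngtP j J) jJ => // h _.
  have : (4 * 4 ^ j <= 4 ^ J)%N by rewrite -expnS leq_exp2l.
  by lia.
have : (4 * 4 ^ J <= 4 ^ j)%N by rewrite -expnS leq_exp2l.
by lia.
Qed.

Let conv_G_Phi J (i : 'I_(4 ^ J)) j x : conv (G j) (Phi (4 ^ J + i)) x =
  if j == J then conv (f J) (wave psi (freq (4 ^ J) i)) x else 0.
Proof.
have [N HN] := Phi_bound (4 ^ J + i).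
rewrite (conv_assoc _ (f_ccont j) (f_bound j) (block_ccont psiP j) (block_int j)
  (Phi_ccont _) (Phi_int _) HN).
have -> : conv (Phi (4 ^ J + i)) (block psi j) =
    fun r => if j == J then wave psi (freq (4 ^ J) i) r else 0.
  by apply/funext => r; exact: Phi_block.
case: eqP => [->//|_]; rewrite /conv.
by under eq_cint do rewrite mulr0; exact: cint0.
Qed.

(** Convolution with the integrable kernel [Phi] commutes with the uniform limit of the partial
    sums, and by [conv_G_Phi] these convolutions are constant as soon as [n > J]. *)
Let conv_F_Phi J (i : 'I_(4 ^ J)) x :
  conv F (Phi (4 ^ J + i)) x = conv (f J) (wave psi (freq (4 ^ J) i)) x.
Proof.
set k := (4 ^ J + i)%N.
have iF := cintegrable_conv x F_ccont F_bound (Phi_int k).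
have iS n := cintegrable_conv x (S_ccont n) (S_bound n) (Phi_int k).
apply: (@cvg_cabs_unique _ (fun n => conv (S n) (Phi k) x)).
  have := tail_cvg (4 * K * L1norm (Phi k)) => /cvgrPdist_lt H.
  apply/cvgrPdist_lt => e /H; apply: filterS => n.
  rewrite !sub0r !normrN [X in _ -> X < _]ger0_norm ?cabs_ge0//.
  apply: le_lt_trans; rewrite (le_trans _ (ler_norm _))//.
  rewrite cabs_distC /conv -cintB//.
  rewrite (mulrAC (4 * K)) [X in _ * X]/L1norm -/(rint _) -rintZ; last first.
    exact: cintegrable_cabs.
  apply: cabs_cint_le; first exact: cintegrableB.
    by apply: rintegrableZ; exact: cintegrable_cabs.
  move=> t; rewrite -mulrBl cabsM ler_wpM2r ?cabs_ge0//.
  by have [_ ->] := FE (x - t).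
apply/cvgrPdist_lt => e e0; near=> n.
have Jn : (J < n)%N by near: n; exact: nbhs_infty_gt.
have -> : conv (S n) (Phi k) x = conv (f J) (wave psi (freq (4 ^ J) i)) x.
  transitivity (\sum_(j < n) conv (G j) (Phi k) x).
    rewrite -cint_sum; last first.
      by move=> j; apply: cintegrable_conv (G_ccont j) (G_bound j) (Phi_int k).
    by apply: eq_cint => t; rewrite /S mulr_suml.
  under eq_bigr do rewrite conv_G_Phi.
  rewrite (bigD1 (Ordinal Jn))//= eqxx big1 ?addr0// => j jJ.
  by rewrite (negbTE (_ : j != J :> nat)).
by rewrite subrr cabs0 subrr normr0.
Unshelve. all: end_near. Qed.

(** The triangle inequality at the peak supplied by [lower]; it does not tell which of the two
    kernels carries the mass. *)
Let norm_pair J (i : 'I_(4 ^ J)) :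
  4 ^- J / 4 <= supnorm (conv F (phik psi (4 ^ J + i).*2%:Z)) +
    supnorm (conv F (phik psi (4 ^ J + i).*2.+1%:Z)).
Proof.
have [x hx] := lower i.
have hk k : cabs (conv F (phik psi k) x) <= supnorm (conv F (phik psi k)).
  apply: (@cabs_le_supnorm _ _ (4 * K * L1norm (phik psi k))) => t.
  exact: cabs_conv F_ccont F_bound (phik_cintegrable psiP k).
apply: le_trans (lerD (hk _) (hk _)); apply: le_trans (cabsD _ _).
have -> : conv F (phik psi (4 ^ J + i).*2%:Z) x +
    conv F (phik psi (4 ^ J + i).*2.+1%:Z) x = conv F (Phi (4 ^ J + i)) x.
  rewrite /conv -cintD.
  - by apply: eq_cint => t; rewrite mulrDr.
  - exact: cintegrable_conv F_ccont F_bound (phik_cintegrable psiP _).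
  - exact: cintegrable_conv F_ccont F_bound (phik_cintegrable psiP _).
rewrite conv_F_Phi.
have -> : conv (f J) (wave psi (freq (4 ^ J) i)) x =
    cofR (4 ^- J) * conv (chirp a (q J)) (wave psi (freq (4 ^ J) i)) x.
  rewrite /conv -cintZ; first by apply: eq_cint => t; rewrite mulrA.
  exact: cintegrable_conv (chirp_ccont _ _) (cabs_chirp_le1 _ _)
    (wave_cintegrable psiP _).
by rewrite cabsM cabs_cofR gtr0_norm// ler_pM2l.
Qed.

Let not_summable : ~ zrseries_cvg (fun k => supnorm (conv F (phik psi k))).
Proof.
move=> [l /cvgrPdist_lt H].
have h8 : 0 < 8^-1 :> R by rewrite invr_gt0.
have [N0 _ HN] := H _ h8.
set b := (fun k : int => _) in HN.
(* With [m + 1 = 4^N0] the window of radius [2m + 1] stops right before the first pair of block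
   [N0]. Both windows have radius at least [N0], so their sums are within [1/8] of [l], yet the
   [4^N0] pairs between them contribute at least [1/4]. *)
pose m := (4 ^ N0)%N.-1.
have mE : m.+1 = (4 ^ N0)%N by rewrite /m prednK// expn_gt0.
have mN : (N0 <= m)%N by rewrite -ltnS mE ltn_expl.
have b0 k : 0 <= b k by exact: supnorm_ge0.
have := @zpartial_pairs _ b m (4 ^ N0)%N b0.
have h1 : `|l - zpart b m.*2.+1| < 8^-1 by apply: HN => /=; lia.
have h2 : `|l - zpart b (m + 4 ^ N0).*2.+1| < 8^-1 by apply: HN => /=; lia.
have h3 : 4^-1 <= \sum_(i < 4 ^ N0) (b (m.+1 + i).*2%:Z + b (m.+1 + i).*2.+1%:Z).
  apply: (@le_trans _ _ (\sum_(i < 4 ^ N0) (4 ^- N0 / 4))).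
    by rewrite sumr_const card_ord -[leRHS]mulr_natr natrX mulrAC mulVf ?mul1r//.
  by apply: ler_sum => i _; rewrite mE; exact: norm_pair.
move: h1 h2; rewrite !ltr_norml => /andP[u1 u2] /andP[u3 u4].
have : 4^-1 = 8^-1 + 8^-1 :> R by field.
by lra.
Qed.

Lemma counterexample_sum : [/\ A0space F, Aspace F, ccont F,
  (exists M : R, forall x, cabs (F x) <= M) & ~ Bspace psi F].
Proof.
split=> //.
- exists f, (block psi); split; first exact: f_C0.
  split; first exact: block_H1.
  by split=> // x; have [] := FE x.
- exists f, (block psi); split.
    by move=> k; split; [exists (4 ^- k); exact: f_bound|exact: f_unif].
  split; first exact: block_H1.
  by split=> // x; have [] := FE x.
- by exists (4 * K).
- by move=> [_ [/not_summable]].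
Qed.

End sum.

Lemma counterexample : exists F : R -> R[i], [/\ A0space F, Aspace F, ccont F,
  (exists M : R, forall x, cabs (F x) <= M) & ~ Bspace psi F].
Proof. by have [F FE] := choice sum_ex; exists F; exact: counterexample_sum. Qed.

End counterexample.

Theorem mainTheorem16 (R : realType) (psi : R -> R) :
  admissible_psi psi ->
  onCplus (Bspace psi) <> onCplus (@Aspace R) /\
  onCplus (B0space psi) <> onCplus (@A0space R).
Proof.
move=> psiP; have [K _ HK] := L1norm_block psiP.
have [a a0 Ha] := chirp_lower psiP.
have /choice[q Hq] : forall j, exists q : R, 0 < q /\ forall i : 'I_(4 ^ j),
    exists x, 4^-1 <= cabs (conv (chirp a q) (wave psi (freq (4 ^ j) i)) x).
  by move=> j; have [q q0 Hq] := Ha _ (fun i : 'I_(4 ^ j) => freq (4 ^ j) i); exists q.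
have [F [A0F AF cF [M FM] nB]] := counterexample psiP a0
  (fun j => (Hq j).1) (fun j => (Hq j).2) HK.
(* Equality of the half-plane spaces only provides some [F'] in the Besov space with the same
   extension as [F]; injectivity of the extension identifies the two. *)
have notB F' : Bspace psi F' -> (forall z : R[i], 0 < cRe z -> tilde F z = tilde F' z) ->
    False.
  move=> BF' FF'; apply: nB; suff -> : F = F' by [].
  have [[[N F'N] uF'] _] := BF'.
  apply: (tilde_inj cF _ FM F'N FF'); apply/ccontP => x e e0.
  by have [d d0 H] := uF' e e0; exists d => // t; exact: H.
split=> E.
  have : onCplus (@Aspace R) (tilde F) by exists F.
  by rewrite -E => -[F' [BF' FF']]; exact: (notB F').
have : onCplus (@A0space R) (tilde F) by exists F.
by rewrite -E => -[F' [[BF' _] FF']]; exact: (notB F').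
Qed.
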